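(* Let $m\ge 1$, let $\boldsymbol\mu\in\mathbb{R}^m$, let $\mathbf{\Sigma}\in\mathbb{R}^{m\times m}$ be symmetric positive semi-definite of rank $k$ with $1\le k\le m$, and let $\mathbf{A}\in\mathbb{R}^{m\times k}$ be any matrix with $\mathbf{\Sigma}=\mathbf{A}\mathbf{A}^T$ (hence of full column rank). Then a random vector $\mathbf{x}\in\mathbb{R}^m$ has a real elliptically symmetric (RES) distribution with symmetry center $\boldsymbol\mu$ and scatter matrix $\mathbf{\Sigma}$ (for some characteristic generator $\phi_r$) if and only if there exist a non-negative real random variable $\mathcal{Q}_{r,k}$ and a random vector $\mathbf{u}_{r,k}$ uniformly distributed on the unit sphere $\{\mathbf{v}\in\mathbb{R}^k:\|\mathbf{v}\|=1\}$, with $\mathcal{Q}_{r,k}$ and $\mathbf{u}_{r,k}$ independent, such that $$\mathbf{x}=_d\boldsymbol\mu+\sqrt{\mathcal{Q}_{r,k}}\,\mathbf{A}\mathbf{u}_{r,k}.$$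
   Context: $=_d$ denotes equality in distribution. A random vector $\mathbf{x}\in\mathbb{R}^m$ is said to have a RES distribution with symmetry center $\boldsymbol\mu\in\mathbb{R}^m$, scatter matrix $\mathbf{\Sigma}$ (an $m\times m$ real symmetric positive semi-definite matrix of rank $k\le m$) and characteristic generator $\phi_r:\mathbb{R}^+\to\mathbb{R}$, written $\mathbf{x}\sim\mathrm{RES}_m(\boldsymbol\mu,\mathbf{\Sigma},\phi_r)$, if its characteristic function is $$\mathrm{E}[\exp(i\mathbf{t}^T\mathbf{x})]=\exp(i\mathbf{t}^T\boldsymbol\mu)\,\phi_r(\mathbf{t}^T\mathbf{\Sigma}\mathbf{t}),\qquad \mathbf{t}\in\mathbb{R}^m.$$ For $k=1$ the uniform distribution on the unit sphere of $\mathbb{R}^1$ is the uniform distribution on $\{-1,+1\}$. *)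

(* Defs.v *)
From HB Require Import structures.
From mathcomp Require Import all_boot all_order all_algebra.
From mathcomp Require Import all_classical all_reals all_analysis.
From mathcomp Require Import complex.

Set Implicit Arguments.
Unset Strict Implicit.
Unset Printing Implicit Defensive.

Import Order.TTheory GRing.Theory Num.Theory.
Import numFieldNormedType.Exports.

Local Open Scope classical_set_scope.
Local Open Scope ring_scope.
Local Open Scope complex_scope.

Definition measure_cV_display : measure_display.
Proof. exact: (default_measure_display). Qed.

(* Column vectors carry the product sigma-algebra, as [n.-tuple R] does in the
   library: a map into ['cV[R]_n] is measurable iff its coordinates are.  Over
   the reals this is the Borel sigma-algebra of [R^n]. *)
Section measurable_cV.
Variables (R : realType) (n : nat).

Let coors : 'I_n -> 'cV[R]_n -> R := fun i v => v i ord0.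

Let cV_set0 : g_sigma_preimage coors set0.
Proof. exact: sigma_algebra0. Qed.

Let cV_setC A : g_sigma_preimage coors A -> g_sigma_preimage coors (~` A).
Proof. exact: sigma_algebraC. Qed.

Let cV_bigcup (F : (set 'cV[R]_n)^nat) :
  (forall i, g_sigma_preimage coors (F i)) ->
  g_sigma_preimage coors (\bigcup_i F i).
Proof. exact: sigma_algebra_bigcup. Qed.

HB.instance Definition _ := @isMeasurable.Build measure_cV_display
  'cV[R]_n (g_sigma_preimage coors) cV_set0 cV_setC cV_bigcup.

End measurable_cV.

(* The library norm [`|v|] on matrices is the sup norm. *)
Definition enorm (R : realType) (n : nat) (v : 'cV[R]_n) : R :=
  Num.sqrt (\sum_(i < n) v i ord0 ^+ 2).

Definition usphere (R : realType) (n : nat) : set 'cV[R]_n :=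
  [set v | enorm v = 1].

Definition dotv (R : realType) (n : nat) (v w : 'cV[R]_n) : R :=
  (v^T *m w) ord0 ord0.

Definition qform (R : realType) (n : nat) (S : 'M[R]_n) (v : 'cV[R]_n) : R :=
  (v^T *m S *m v) ord0 ord0.

Definition sym_psd (R : realType) (n : nat) (S : 'M[R]_n) : Prop :=
  S^T = S /\ forall v, 0 <= qform S v.

(* n-dimensional Lebesgue measure as the iterated product of the
   one-dimensional one: the measure of [B] is the integral of the measures of
   its sections along the first coordinate.  As for [\x], the value is
   meaningful on measurable sets. *)
Fixpoint lebesgue_cV (R : realType) (n : nat) : set 'cV[R]_n -> \bar R :=
  match n with
  | 0 => fun B => \d_(0 : 'cV[R]_0) B
  | n'.+1 => fun B => (\int[@lebesgue_measure R]_x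
      lebesgue_cV [set v : 'cV[R]_n' | B (col_mx (x%:M : 'cV[R]_1) v)])%E
  end.

Definition cone (R : realType) (n : nat) (B : set 'cV[R]_n) : set 'cV[R]_n :=
  [set x | exists r : R, exists w : 'cV[R]_n,
     [/\ 0 < r <= 1, w \in B & x = r *: w]].

(* Surface measure of [B `&` usphere]: n times the volume of the solid cone
   over it, so that polar coordinates read dx = r^(n-1) dr dsigma. *)
Definition sphere_area (R : realType) (n : nat) (B : set 'cV[R]_n) : \bar R :=
  (n%:R%:E * lebesgue_cV (cone (B `&` @usphere R n)))%E.

Definition uniform_on_sphere d (T : measurableType d) (R : realType)
    (P : probability T R) (n : nat) (u : {RV P >-> 'cV[R]_n}) : Prop :=
  forall B : set 'cV[R]_n, measurable B ->
    distribution P u B = (sphere_area B / sphere_area [set: 'cV[R]_n])%E.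

Definition independent_RV d d1 d2 (T : measurableType d)
    (T1 : measurableType d1) (T2 : measurableType d2) (R : realType)
    (P : probability T R) (X : {RV P >-> T1}) (Y : {RV P >-> T2}) : Prop :=
  forall (A : set T1) (B : set T2), measurable A -> measurable B ->
    P (X @^-1` A `&` Y @^-1` B) = (P (X @^-1` A) * P (Y @^-1` B))%E.

(* Restricting to measurable sets matters: a measure is an arbitrary function
   on the non-measurable ones. *)
Definition eq_in_distribution d1 d2 d (T1 : measurableType d1)
    (T2 : measurableType d2) (T : measurableType d) (R : realType)
    (P1 : probability T1 R) (P2 : probability T2 R)
    (X : T1 -> T) (Y : T2 -> T) : Prop :=
  forall B : set T, measurable B -> pushforward P1 X B = pushforward P2 Y B.

Definition expi (R : realType) (a : R) : R[i] := cos a +i* sin a.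

Definition complex_expectation d (T : measurableType d) (R : realType)
    (P : probability T R) (Z : T -> R[i]) : R[i] :=
  (\int[P]_w complex.Re (Z w)) +i* (\int[P]_w complex.Im (Z w)).

Definition char_fun d (T : measurableType d) (R : realType)
    (P : probability T R) (n : nat) (X : {RV P >-> 'cV[R]_n})
    (t : 'cV[R]_n) : R[i] :=
  complex_expectation P (fun w => expi (dotv t (X w))).

(* [phi] is total on [R], but as [S] is positive semi-definite only its
   restriction to the non-negative reals is used. *)
Definition RES d (T : measurableType d) (R : realType)
    (P : probability T R) (n : nat) (X : {RV P >-> 'cV[R]_n})
    (mu : 'cV[R]_n) (S : 'M[R]_n) (phi : R -> R) : Prop :=
  sym_psd S /\
  forall t : 'cV[R]_n,
    char_fun X t = expi (dotv t mu) * (phi (qform S t))%:C.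

(* Main.v *)
Require Import Defs.
From HB Require Import structures.
From mathcomp Require Import all_boot all_order all_algebra.
From mathcomp Require Import all_classical all_reals all_analysis.
From mathcomp Require Import measurable_realfun complex.
From mathcomp Require Import ring lra.

Set Implicit Arguments.
Unset Strict Implicit.
Unset Printing Implicit Defensive.

Import Order.TTheory GRing.Theory Num.Theory.
Import numFieldNormedType.Exports.

Local Open Scope classical_set_scope.
Local Open Scope ring_scope.

(**
  Write [Sigma = A A^T] with [A] of full column rank [k], and let [L] be a left
  inverse of [A].

  If [x] is distributed as [mu + sqrt Q A u], then conditionally on [Q] its
  characteristic function at [t] is, up to the factor [exp (i t.mu)], that of
  the uniform vector [u] at [sqrt Q A^T t].  The law of [u] is invariant under
  orthogonal maps, so this depends on [t] only through the norm of [A^T t],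
  whose square is the quadratic form of [Sigma] at [t]; and it is real as [u]
  and [- u] have the same law.  This is [stochastic_representation_RES].

  Conversely, if [x] is elliptical then the characteristic function of
  [y = L (x - mu)] is radial ([RES_whitened]).  Take [u] uniform on the sphere
  and independent of [x], and [Q] the squared norm of [y].  Exchanging the
  averages over [y] and [u] shows that [|y| u] has the same radial
  characteristic function as [y] ([spherical_mixture]), hence
  [mu + |y| A u] has the characteristic function of [x], and the two have the
  same law.

  Two general facts carry the argument.

  - A finite measure on column vectors is determined by its characteristic
    function ([fourier_unique]).  The bounded functions by which one may
    multiply two measures without destroying the equality of their
    characteristic functions form an algebra closed under bounded pointwise
    limits and containing every [sin (s.x)].  The sets whose indicators belong
    to it form a sigma-algebra; the coordinates are measurable for it, as
    limits of rescaled sines.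

  - Lebesgue measure on column vectors, defined by iterated integration, is
    invariant under orthogonal maps ([lebV_orthogonal]).  This follows from
    translation invariance by a Fubini argument.  Surface measure, defined by
    the volume of cones, inherits the invariance, and reflections
    ([householder]) move any vector to any other one of the same norm.
*)

(** * Measurability and Euclidean geometry of column vectors *)

Lemma measurable_preimageT d1 d2 (T1 : measurableType d1) (T2 : measurableType d2)
    (f : T1 -> T2) (B : set T2) :
  measurable_fun setT f -> measurable B -> measurable (f @^-1` B).
Proof. by move=> mf mB; rewrite -[X in measurable X]setTI; exact: mf. Qed.

Section measurable_vectors.
Context (R : realType).

Lemma measurable_coord n (i : 'I_n) :
  measurable_fun [set: 'cV[R]_n] (fun v : 'cV[R]_n => v i ord0).
Proof.
move=> _ Y mY; rewrite setTI; apply: sub_sigma_algebra => /=.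
rewrite -bigcup_seq/=; exists i => /=; first by rewrite mem_index_enum.
by exists Y => //; rewrite setTI.
Qed.

(** The sets with measurable preimage under [f] form a sigma-algebra, and it
    contains the generators of the one on column vectors. *)
Lemma measurable_fun_cV d (T : measurableType d) n (f : T -> 'cV[R]_n) :
  (forall i, measurable_fun setT (fun w => f w i ord0)) -> measurable_fun setT f.
Proof.
move=> mf _ B mB; rewrite setTI.
pose S : set (set 'cV[R]_n) := [set A | measurable (f @^-1` A)].
apply: (mB S); split; first split => /=.
- by rewrite /S/= preimage_set0; exact: measurable0.
- by move=> A mA; rewrite /S/= setTD preimage_setC; exact: measurableC.
- by move=> F mF; rewrite /S/= preimage_bigcup; apply: bigcup_measurable => k _; exact: mF.
move=> A; rewrite -bigcup_seq => -[i _ [C mC <-]].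
by rewrite /S/= setTI; have := mf i measurableT C mC; rewrite setTI.
Qed.

Lemma measurable_mulmx d (T : measurableType d) m n (A : 'M[R]_(m, n))
    (f : T -> 'cV[R]_n) :
  measurable_fun setT f -> measurable_fun setT (fun w => A *m f w).
Proof.
move=> mf; apply: measurable_fun_cV => i.
under eq_fun do rewrite mxE.
apply: measurable_sum => j; apply: measurable_funM => //.
exact: (measurableT_comp (measurable_coord j) mf).
Qed.

Lemma measurable_addcV d (T : measurableType d) n (f g : T -> 'cV[R]_n) :
  measurable_fun setT f -> measurable_fun setT g ->
  measurable_fun setT (fun w => f w + g w).
Proof.
move=> mf mg; apply: measurable_fun_cV => i; under eq_fun do rewrite mxE.
apply: measurable_funD; exact: (measurableT_comp (measurable_coord i)).
Qed.

Lemma measurable_scalecV d (T : measurableType d) n (r : T -> R)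
    (f : T -> 'cV[R]_n) :
  measurable_fun setT r -> measurable_fun setT f ->
  measurable_fun setT (fun w => r w *: f w).
Proof.
move=> mf mg; apply: measurable_fun_cV => i; under eq_fun do rewrite mxE.
by apply: measurable_funM => //; exact: (measurableT_comp (measurable_coord i)).
Qed.

Lemma dotvE n (v w : 'cV[R]_n) : dotv v w = \sum_i v i ord0 * w i ord0.
Proof. by rewrite /dotv mxE; apply: eq_bigr => i _; rewrite mxE. Qed.

Lemma measurable_dotv d (T : measurableType d) n (f g : T -> 'cV[R]_n) :
  measurable_fun setT f -> measurable_fun setT g ->
  measurable_fun setT (fun w => dotv (f w) (g w)).
Proof.
move=> mf mg; under eq_fun do rewrite dotvE.
apply: measurable_sum => i.
apply: measurable_funM; exact: (measurableT_comp (measurable_coord i)).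
Qed.

Lemma enormE n (v : 'cV[R]_n) : enorm v = Num.sqrt (dotv v v).
Proof. by rewrite dotvE. Qed.

Lemma measurable_sqrt : measurable_fun setT (@Num.sqrt R).
Proof. by apply: continuous_measurable_fun => x; exact: sqrt_continuous. Qed.

Lemma measurable_enorm d (T : measurableType d) n (f : T -> 'cV[R]_n) :
  measurable_fun setT f -> measurable_fun setT (fun w => enorm (f w)).
Proof.
move=> mf; under eq_fun do rewrite enormE.
by apply: measurableT_comp; [exact: measurable_sqrt | exact: measurable_dotv].
Qed.

End measurable_vectors.

Section vectors.
Context (R : realType) (n : nat).
Implicit Types (v w : 'cV[R]_n).

Lemma dotvC v w : dotv v w = dotv w v.
Proof. by rewrite !dotvE; apply: eq_bigr => i _; rewrite mulrC. Qed.

Lemma dotvDr v w z : dotv v (w + z) = dotv v w + dotv v z.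
Proof. by rewrite /dotv mulmxDr mxE. Qed.

Lemma dotvZr a v w : dotv v (a *: w) = a * dotv v w.
Proof. by rewrite /dotv -scalemxAr mxE. Qed.

Lemma dotvNr v w : dotv v (- w) = - dotv v w.
Proof. by rewrite /dotv mulmxN mxE. Qed.

Lemma dotvDl v w z : dotv (w + z) v = dotv w v + dotv z v.
Proof. by rewrite ![dotv _ v]dotvC dotvDr. Qed.

Lemma dotvZl a v w : dotv (a *: v) w = a * dotv v w.
Proof. by rewrite ![dotv _ w]dotvC dotvZr. Qed.

Lemma dotvNl v w : dotv (- v) w = - dotv v w.
Proof. by rewrite ![dotv _ w]dotvC dotvNr. Qed.

Lemma dotvv_ge0 v : 0 <= dotv v v.
Proof. by rewrite dotvE sumr_ge0// => i _; rewrite -expr2 sqr_ge0. Qed.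

Lemma dotvv_eq0 v : dotv v v = 0 -> v = 0.
Proof.
rewrite dotvE => /eqP; rewrite psumr_eq0 => [/allP h|i _]; last first.
  by rewrite -expr2 sqr_ge0.
apply/matrixP => i j; rewrite ord1 mxE.
by have /implyP/(_ isT) := h i (mem_index_enum _); rewrite -expr2 sqrf_eq0 => /eqP.
Qed.

Lemma enorm_ge0 v : 0 <= enorm v. Proof. exact: sqrtr_ge0. Qed.

Lemma enorm_sqr v : enorm v ^+ 2 = dotv v v.
Proof. by rewrite enormE sqr_sqrtr// dotvv_ge0. Qed.

Lemma enorm_eq0 v : enorm v = 0 -> v = 0.
Proof. by move=> v0; apply: dotvv_eq0; rewrite -enorm_sqr v0 expr0n. Qed.

Lemma enormZ a v : enorm (a *: v) = `|a| * enorm v.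
Proof.
rewrite !enormE dotvZl dotvZr mulrA -expr2 sqrtrM ?sqr_ge0//.
by rewrite sqrtr_sqr.
Qed.

Lemma enorm0 : enorm (0 : 'cV[R]_n) = 0.
Proof. by rewrite -(scale0r (0 : 'cV[R]_n)) enormZ normr0 mul0r. Qed.

Lemma enorm_gt0 v : v != 0 -> 0 < enorm v.
Proof.
rewrite lt_neqAle enorm_ge0 andbT [0 == _]eq_sym.
by apply: contraNN => /eqP h; apply/eqP; exact/enorm_eq0.
Qed.

End vectors.

Lemma dotv_mulmxr (R : realType) m n (A : 'M[R]_(m, n)) (v : 'cV[R]_m) (w : 'cV[R]_n) :
  dotv v (A *m w) = dotv (A^T *m v) w.
Proof. by rewrite /dotv trmx_mul trmxK mulmxA. Qed.

(** * Three elementary limits *)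

Section real_limits.
Context (R : realType).

Lemma cvg_exprn_lt1 (z : R) : 0 <= z < 1 -> z ^+ k @[k --> \oo] --> (0 : R).
Proof. by move=> /andP[z0 z1]; apply: cvg_expr; rewrite ger0_norm. Qed.

Lemma bernoulli_expr_oneB (z : R) k :
  0 <= z <= 1 -> 1 - k%:R * z <= (1 - z) ^+ k.
Proof.
move=> /andP[z0 z1]; elim: k => [|k IH]; first by rewrite mul0r subr0.
rewrite exprS; have : (1 - z) * (1 - k%:R * z) <= (1 - z) * (1 - z) ^+ k.
  by rewrite ler_wpM2l// subr_ge0.
apply: le_trans; rewrite -natr1.
have : 0 <= k%:R * (z * z) by rewrite !mulr_ge0.
by lra.
Qed.

(** The reciprocal Bernoulli inequality: [(1 - z) ^+ k * (1 + k%:R * z)] starts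
    at 1 and decreases with [k], because
    [(1 - z) * (1 + (k + 1) z) <= 1 + k z]. *)
Lemma expr_oneB_mul_le1 (z : R) k :
  0 <= z <= 1 -> (1 - z) ^+ k * (k%:R * z) <= 1.
Proof.
move=> /andP[z0 z1].
suff : (1 - z) ^+ k * (1 + k%:R * z) <= 1.
  by apply: le_trans; rewrite ler_wpM2l ?exprn_ge0 ?subr_ge0// lerDr.
elim: k => [|k IH]; first by rewrite mul0r addr0 mulr1.
apply: le_trans IH; rewrite exprSr -mulrA ler_wpM2l ?exprn_ge0 ?subr_ge0//.
rewrite -natr1; have : 0 <= k%:R * (z * z) by rewrite !mulr_ge0.
have : 0 <= z * z by rewrite mulr_ge0.
by lra.
Qed.

(** With the next lemma: the polynomials [(1 - y ^+ k) ^+ (2 ^ k)] tend to a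
    step at [1/2] on the unit interval, since [2 ^ k * y ^+ k = (2 * y) ^+ k]
    vanishes or explodes according to the side of [1/2] on which [y] lies.  At
    [y = 1/2] itself the limit is neither 0 nor 1. *)
Lemma cvg_step_lt (y : R) : 0 <= y < 2^-1 ->
  (1 - y ^+ k) ^+ (2 ^ k) @[k --> \oo] --> (1 : R).
Proof.
move=> /andP[y0 y2].
have y1 : y <= 1 by lra.
apply: (@squeeze_cvgr _ _ _ _ (fun k => 1 - (2 * y) ^+ k) (cst 1)).
- apply: nearW => k; apply/andP; split.
    by rewrite exprMn -natrX bernoulli_expr_oneB// exprn_ge0// exprn_ile1.
  by rewrite exprn_ile1// ?subr_ge0 ?exprn_ile1// lerBlDr lerDl exprn_ge0.
- rewrite -[X in _ --> X]subr0; apply: cvgB; first exact: cvg_cst.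
  by apply: cvg_exprn_lt1; lra.
- exact: cvg_cst.
Qed.

Lemma cvg_step_gt (y : R) : 2^-1 < y <= 1 ->
  (1 - y ^+ k) ^+ (2 ^ k) @[k --> \oo] --> (0 : R).
Proof.
move=> /andP[y2 y1].
have y0 : 0 <= y by lra.
apply: (@squeeze_cvgr _ _ _ _ (cst 0) (fun k => ((2 * y)^-1) ^+ k)).
- apply: nearW => k; apply/andP; split.
    by rewrite exprn_ge0// subr_ge0 exprn_ile1.
  rewrite exprVn -[leRHS]mul1r ler_pdivlMr; last by apply: exprn_gt0; lra.
  by rewrite exprMn -natrX expr_oneB_mul_le1// exprn_ge0// exprn_ile1.
- exact: cvg_cst.
- by apply: cvg_exprn_lt1; rewrite invr_ge0 invf_lt1; lra.
Qed.

(** The derivative of [sin] at 0 is 1. Applied to a coordinate of a vector, this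
    recovers the coordinate from bounded trigonometric functions. *)
Lemma cvg_sin_scaled (x : R) :
  k.+1%:R * sin (k.+1%:R^-1 * x) @[k --> \oo] --> x.
Proof.
have [->|x0] := eqVneq x 0.
  under eq_fun do rewrite mulr0 sin0 mulr0.
  exact: cvg_cst.
have ds := @is_derive_sin R 0.
have hl : h^-1 *: (sin (h *: 1 + 0) - sin 0 : R) @[h --> 0^'] --> (1 : R).
  have /cvg_ex[l hl] := @ex_derive _ _ _ _ _ _ _ ds.
  suff lE : l = 1 by rewrite lE in hl.
  by rewrite -(cvg_lim _ hl)// -[LHS]/('D_1 sin 0) derive_val cos0.
have h0 : (k.+1%:R^-1 * x) @[k --> \oo] --> (0 : R)^'.
  have h1 : (k.+1%:R^-1 * x) @[k --> \oo] --> (0 : R).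
    by rewrite -(mul0r x); apply: cvgM; [exact: cvg_harmonic | exact: cvg_cst].
  move=> A hA; have [N _ hN] := h1 [set y | y != 0 -> A y] hA.
  exists N => // k Nk; apply: (hN k Nk).
  by rewrite mulf_neq0// invr_eq0 pnatr_eq0.
have h2 := cvg_comp _ _ h0 hl.
rewrite -[X in _ --> X]mul1r.
apply: cvg_trans (cvgM h2 (cvg_cst x)).
apply: near_eq_cvg; apply: nearW => k /=.
rewrite sin0 subr0 addr0 /GRing.scale/= mulr1 invfM invrK.
by rewrite mulrAC divfK.
Qed.

End real_limits.

(** * Bounded measurable functions *)

Section bounded_measurable.
Context d (T : measurableType d) (R : realType).
Implicit Types (f g : T -> R).

Definition bounded_mfun f :=
  measurable_fun setT f /\ exists M : R, forall x, `|f x| <= M.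

Lemma bounded_mfun_cst c : bounded_mfun (fun=> c).
Proof. by split => //; exists `|c|. Qed.

Lemma bounded_mfunD f g : bounded_mfun f -> bounded_mfun g ->
  bounded_mfun (fun x => f x + g x).
Proof.
move=> [mf [M fM]] [mg [N gN]]; split; first exact: measurable_funD.
by exists (M + N) => x; rewrite (le_trans (ler_normD _ _))// lerD.
Qed.

Lemma bounded_mfunM f g : bounded_mfun f -> bounded_mfun g ->
  bounded_mfun (fun x => f x * g x).
Proof.
move=> [mf [M fM]] [mg [N gN]]; split; first exact: measurable_funM.
by exists (M * N) => x; rewrite normrM ler_pM.
Qed.

Lemma bounded_mfun_cos f : measurable_fun setT f ->
  bounded_mfun (fun x => cos (f x)).
Proof.
move=> mf; split; last by exists 1 => x; exact: cos_max.
apply: measurableT_comp => //.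
by apply: continuous_measurable_fun; exact: continuous_cos.
Qed.

Lemma bounded_mfun_sin f : measurable_fun setT f ->
  bounded_mfun (fun x => sin (f x)).
Proof.
move=> mf; split; last by exists 1 => x; exact: sin_max.
apply: measurableT_comp => //.
by apply: continuous_measurable_fun; exact: continuous_sin.
Qed.

Lemma bounded_mfun_indic B : measurable B -> bounded_mfun (\1_B : T -> R).
Proof.
move=> mB; split; first exact: measurable_indic.
by exists 1 => x; rewrite indicE; case: (x \in B); rewrite ?normr1 ?normr0.
Qed.

Variable P : {finite_measure set T -> \bar R}.

Lemma bounded_mfun_integrable f : bounded_mfun f ->
  P.-integrable setT (EFin \o f).
Proof.
move=> [mf [M fM]]; apply: measurable_bounded_integrable => //.
  by rewrite ltey_eq fin_num_measure.
exists `|M|; split => // N MN x _ /=.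
by rewrite (le_trans (fM x))// (le_trans (ler_norm _))// ltW.
Qed.

Lemma bounded_mfun_EFin_Rintegral f : bounded_mfun f ->
  (\int[P]_x f x)%:E = (\int[P]_x (f x)%:E)%E.
Proof.
move=> bf; rewrite /Rintegral fineK//.
by apply: integrable_fin_num => //; exact: bounded_mfun_integrable.
Qed.

(** Dominated convergence, the dominating function being the constant [M]. *)
Lemma cvg_Rintegral (f_ : nat -> T -> R) f (M : R) :
  (forall n, measurable_fun setT (f_ n)) -> (forall n x, `|f_ n x| <= M) ->
  (forall x, f_ ^~ x @ \oo --> f x) ->
  bounded_mfun f /\ (\int[P]_x f_ n x @[n --> \oo] --> \int[P]_x f x).
Proof.
move=> mf fM ff.
have bf : bounded_mfun f.
  split; first exact: (@measurable_fun_cvg _ _ _ setT f_ f).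
  exists M => x; have h : `|f_ n x| @[n --> \oo] --> `|f x| by exact: cvg_norm (ff x).
  rewrite -(cvg_lim _ h)//.
  apply: limr_le; first by apply/cvg_ex; exists `|f x|; exact: cvg_norm.
  by near=> n.
split=> //.
have eff x : EFin \o f_ ^~ x @ \oo --> (f x)%:E.
  by apply: cvg_EFin; [exact: nearW | exact: ff].
have [_ _ h] := @dominated_convergence _ T R P setT measurableT
  (fun n => EFin \o f_ n) (EFin \o f) (EFin \o cst M)
  (fun n => (measurable_EFinP _ _).2 (mf n)) ((measurable_EFinP _ _).2 bf.1)
  (aeW _ (fun x _ => eff x))
  (bounded_mfun_integrable (bounded_mfun_cst M))
  (aeW _ (fun x n _ => fM n x)).
rewrite /Rintegral; apply: fine_cvg.
by rewrite fineK//; apply: integrable_fin_num => //; exact: bounded_mfun_integrable.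
Unshelve. all: by end_near. Qed.

End bounded_measurable.

Lemma bounded_mfun_comp d1 d2 (T1 : measurableType d1) (T2 : measurableType d2)
    (R : realType) (h : T1 -> T2) (f : T2 -> R) :
  measurable_fun setT h -> bounded_mfun f -> bounded_mfun (fun x => f (h x)).
Proof.
move=> mh [mf [M fM]]; split; first exact: measurableT_comp.
by exists M.
Qed.

(** * Uniqueness of characteristic functions *)

Section characteristic_function_uniqueness.
Context (R : realType) (n : nat).
Notation V := 'cV[R]_n.
Variables mu nu : {finite_measure set V -> \bar R}.
Implicit Types (f g h : V -> R).

(** The density [f] is carried along so that this class is stable under
    multiplication by trigonometric functions; the constant density 1 says that
    [mu] and [nu] have the same characteristic function. *)
Definition same_fourier f := bounded_mfun f /\ forall t : V,
  \int[mu]_x (f x * cos (dotv t x)) = \int[nu]_x (f x * cos (dotv t x)) /\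
  \int[mu]_x (f x * sin (dotv t x)) = \int[nu]_x (f x * sin (dotv t x)).

(** Quantifying over all densities [f] makes multipliers closed under products
    by definition, so that polynomials in multipliers need no expansion into
    trigonometric monomials. *)
Definition fourier_multiplier g := bounded_mfun g /\
  forall f, same_fourier f -> same_fourier (fun x => g x * f x).

Let mdot (t : V) : measurable_fun setT (fun x : V => dotv t x).
Proof. exact: measurable_dotv. Qed.

Let bcos t : bounded_mfun (fun x : V => cos (dotv t x)).
Proof. by apply: bounded_mfun_cos; exact: mdot. Qed.

Let bsin t : bounded_mfun (fun x : V => sin (dotv t x)).
Proof. by apply: bounded_mfun_sin; exact: mdot. Qed.

Let intM (m : {finite_measure set V -> \bar R}) f g :
  bounded_mfun f -> bounded_mfun g ->
  m.-integrable setT (EFin \o (fun x => f x * g x)).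
Proof. by move=> bf bg; apply/bounded_mfun_integrable/bounded_mfunM. Qed.

Lemma same_fourierD f g : same_fourier f -> same_fourier g ->
  same_fourier (fun x => f x + g x).
Proof.
move=> [bf Ff] [bg Fg]; split; first exact: bounded_mfunD.
move=> t; have [fc fs] := Ff t; have [gc gs] := Fg t; split.
- under eq_Rintegral do rewrite mulrDl.
  under [RHS]eq_Rintegral do rewrite mulrDl.
  by rewrite !RintegralD//; [rewrite fc gc | exact: intM..].
- under eq_Rintegral do rewrite mulrDl.
  under [RHS]eq_Rintegral do rewrite mulrDl.
  by rewrite !RintegralD//; [rewrite fs gs | exact: intM..].
Qed.

Lemma same_fourierZ c f : same_fourier f -> same_fourier (fun x => c * f x).
Proof.
move=> [bf Ff]; split; first exact: bounded_mfunM (bounded_mfun_cst _ c) bf.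
move=> t; have [fc fs] := Ff t; split.
- under eq_Rintegral do rewrite -mulrA.
  under [RHS]eq_Rintegral do rewrite -mulrA.
  by rewrite !RintegralZl//; [rewrite fc | exact: intM..].
- under eq_Rintegral do rewrite -mulrA.
  under [RHS]eq_Rintegral do rewrite -mulrA.
  by rewrite !RintegralZl//; [rewrite fs | exact: intM..].
Qed.

Lemma same_fourier_lim (f_ : nat -> V -> R) f (M : R) :
  (forall k x, `|f_ k x| <= M) -> (forall x, f_ ^~ x @ \oo --> f x) ->
  (forall k, same_fourier (f_ k)) -> same_fourier f.
Proof.
move=> fM ff Ff.
have [bf _] := cvg_Rintegral mu (fun k => (Ff k).1.1) fM ff.
split=> // t.
have lim (m : {finite_measure set V -> \bar R}) u : bounded_mfun u ->
    (forall x, `|u x| <= 1) ->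
    \int[m]_x (f_ k x * u x) @[k --> \oo] --> \int[m]_x (f x * u x).
  move=> bu u1.
  apply: (@cvg_Rintegral _ V R m (fun k x => f_ k x * u x) _ M _ _ _).2.
  - by move=> k; exact: (bounded_mfunM (Ff k).1 bu).1.
  - move=> k x; rewrite normrM -(mulr1 M) ler_pM ?normr_ge0 ?fM ?u1//.
  - by move=> x; apply: cvgM; [exact: ff | exact: cvg_cst].
split.
- have h1 := lim mu _ (bcos t) (fun x => cos_max _).
  have h2 := lim nu _ (bcos t) (fun x => cos_max _).
  rewrite -(cvg_lim _ h1)// -(cvg_lim _ h2)//.
  by congr (limn _); apply/funext => k; have [] := (Ff k).2 t.
- have h1 := lim mu _ (bsin t) (fun x => sin_max _).
  have h2 := lim nu _ (bsin t) (fun x => sin_max _).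
  rewrite -(cvg_lim _ h1)// -(cvg_lim _ h2)//.
  by congr (limn _); apply/funext => k; have [] := (Ff k).2 t.
Qed.

(** The product-to-sum formulas express the Fourier integrals of
    [sin (dotv s x) * f x] at [t] by those of [f] at [t + s] and [t - s]. *)
Lemma fourier_multiplier_sin (s : V) :
  fourier_multiplier (fun x => sin (dotv s x)).
Proof.
split; first exact: bsin.
move=> f [bf Ff]; split; first exact: bounded_mfunM.
move=> t; have [pc ps] := Ff (t + s); have [mc ms] := Ff (t - s).
have half (m : {finite_measure set V -> \bar R}) u v w :
    bounded_mfun u -> bounded_mfun v ->
    (forall x, w x = 2^-1 * (f x * u x) - 2^-1 * (f x * v x)) ->
    \int[m]_x w x =
    2^-1 * \int[m]_x (f x * u x) - 2^-1 * \int[m]_x (f x * v x).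
  move=> bu bv wE; under eq_Rintegral do rewrite wE.
  have bz (z : V -> R) : bounded_mfun z ->
      m.-integrable setT (EFin \o (fun x => 2^-1 * (f x * z x))).
    move=> bz; apply: bounded_mfun_integrable.
    exact: bounded_mfunM (bounded_mfun_cst _ _) (bounded_mfunM bf bz).
  by rewrite RintegralB ?bz// !RintegralZl// ; exact: intM.
have sinE (m : {finite_measure set V -> \bar R}) :
    \int[m]_x (sin (dotv s x) * f x * cos (dotv t x)) =
    2^-1 * \int[m]_x (f x * sin (dotv (t + s) x)) -
    2^-1 * \int[m]_x (f x * sin (dotv (t - s) x)).
  apply: half; [exact: bsin | exact: bsin | move=> x].
  by rewrite !dotvDl dotvNl sinD sinB; field.
have cosE (m : {finite_measure set V -> \bar R}) :
    \int[m]_x (sin (dotv s x) * f x * sin (dotv t x)) =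
    2^-1 * \int[m]_x (f x * cos (dotv (t - s) x)) -
    2^-1 * \int[m]_x (f x * cos (dotv (t + s) x)).
  apply: half; [exact: bcos | exact: bcos | move=> x].
  by rewrite !dotvDl dotvNl cosB cosD; field.
by split; rewrite ?sinE ?cosE ?pc ?ps ?mc ?ms.
Qed.

Lemma fourier_multiplierD f g : fourier_multiplier f -> fourier_multiplier g ->
  fourier_multiplier (fun x => f x + g x).
Proof.
move=> [bf Ff] [bg Fg]; split; first exact: bounded_mfunD.
move=> h Fh; have := same_fourierD (Ff _ Fh) (Fg _ Fh).
by congr same_fourier; apply/funext => x; rewrite mulrDl.
Qed.

Lemma fourier_multiplierM f g : fourier_multiplier f -> fourier_multiplier g ->
  fourier_multiplier (fun x => f x * g x).
Proof.
move=> [bf Ff] [bg Fg]; split; first exact: bounded_mfunM.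
move=> h Fh; have := Ff _ (Fg _ Fh).
by congr same_fourier; apply/funext => x; rewrite mulrA.
Qed.

Lemma fourier_multiplier_cst c : fourier_multiplier (fun=> c).
Proof.
by split; [exact: bounded_mfun_cst | move=> f; exact: same_fourierZ].
Qed.

Lemma fourier_multiplierX f k : fourier_multiplier f ->
  fourier_multiplier (fun x => f x ^+ k).
Proof.
move=> Ff; elim: k => [|k IH]; first exact: fourier_multiplier_cst.
under eq_fun do rewrite exprS.
exact: fourier_multiplierM.
Qed.

Lemma fourier_multiplier_oneB f : fourier_multiplier f ->
  fourier_multiplier (fun x => 1 - f x).
Proof.
move=> Ff; under eq_fun do rewrite -mulN1r.
apply: fourier_multiplierD; first exact: fourier_multiplier_cst.
by apply: fourier_multiplierM => //; exact: fourier_multiplier_cst.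
Qed.

Lemma fourier_multiplier_lim (f_ : nat -> V -> R) f (M : R) :
  (forall k x, `|f_ k x| <= M) -> (forall x, f_ ^~ x @ \oo --> f x) ->
  (forall k, fourier_multiplier (f_ k)) -> fourier_multiplier f.
Proof.
move=> fM ff Ff.
split; first exact: (cvg_Rintegral mu (fun k => (Ff k).1.1) fM ff).1.
move=> h Fh; have [_ [N hN]] := Fh.1.
apply: (@same_fourier_lim (fun k x => f_ k x * h x) _ (M * N)).
- by move=> k x; rewrite normrM ler_pM.
- by move=> x; apply: cvgM; [exact: ff | exact: cvg_cst].
- by move=> k; exact: (Ff k).2.
Qed.

Definition fourier_set (B : set V) :=
  measurable B /\ fourier_multiplier (\1_B : V -> R).

Lemma fourier_setC B : fourier_set B -> fourier_set (~` B).
Proof.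
move=> [mB FB]; split; first exact: measurableC.
have := fourier_multiplier_oneB FB; congr fourier_multiplier.
apply/funext => x; rewrite !indicE in_setC.
by case: (x \in B); rewrite ?subr0 ?subrr.
Qed.

Lemma fourier_setI A B : fourier_set A -> fourier_set B -> fourier_set (A `&` B).
Proof.
move=> [mA FA] [mB FB]; split; first exact: measurableI.
by rewrite indicI; exact: fourier_multiplierM.
Qed.

Lemma fourier_set0 : fourier_set set0.
Proof. by split => //; rewrite indic0; exact: fourier_multiplier_cst. Qed.

Lemma fourier_setU A B : fourier_set A -> fourier_set B -> fourier_set (A `|` B).
Proof.
move=> FA FB; rewrite -(setCK (A `|` B)) setCU.
by apply/fourier_setC/fourier_setI; exact: fourier_setC.
Qed.

(** The partial unions converge boundedly to the countable one. *)
Lemma fourier_set_bigcup (F : nat -> set V) :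
  (forall k, fourier_set (F k)) -> fourier_set (\bigcup_k F k).
Proof.
move=> FF; split; first by apply: bigcup_measurable => k _; exact: (FF k).1.
have FS k : fourier_set (\bigcup_(i < k) F i).
  rewrite bigcup_mkord; elim: k => [|k IH].
    by rewrite big_ord0; exact: fourier_set0.
  by rewrite big_ord_recr; exact: fourier_setU.
apply: (@fourier_multiplier_lim (fun k => \1_(\bigcup_(i < k) F i)) _ 1).
- by move=> k x; rewrite indicE; case: (x \in _); rewrite ?normr1 ?normr0.
- move=> x; have [Fx|nFx] := pselect ((\bigcup_k F k) x).
    have [i _ Fix] := Fx.
    apply: cvg_near_cst.
    exists i.+1 => // k /= ik; rewrite !indicE.
    by rewrite !mem_set//; exists i.
  rewrite indicE memNset//.
  rewrite (_ : (fun k => _) = cst 0); first exact: cvg_cst.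
  apply/funext => k /=; rewrite indicE memNset// => -[i _ Fix].
  by apply: nFx; exists i.
- by move=> k; exact: (FS k).2.
Qed.

Lemma fourier_set_sigma_algebra : sigma_algebra setT fourier_set.
Proof.
split; first exact: fourier_set0.
- by move=> B FB; rewrite setTD; exact: fourier_setC.
- exact: fourier_set_bigcup.
Qed.

(** Up to scaling [f] has values between -1 and 1. With [y = 1/2 + f/4], the
    step polynomials in [y] detect the sign of [f] except where [f = 0], and
    there the factor [1 - (1 - f ^+ 2) ^+ k.+1], which tends to the indicator
    of [f != 0], forces the limit 0. *)
Lemma fourier_multiplier_lt0 f : fourier_multiplier f ->
  fourier_set [set x | f x < 0].
Proof.
move=> Ff.
wlog f1 : f Ff / forall x, `|f x| <= 1.
  move=> wl; have [_ [M fM]] := Ff.1.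
  have M1 : 0 < `|M| + 1 by rewrite ltr_pwDr.
  have -> : [set x | f x < 0] = [set x | (`|M| + 1)^-1 * f x < 0].
    by apply/seteqP; split => x /=; rewrite pmulr_rlt0// invr_gt0.
  apply: wl; first by apply: fourier_multiplierM => //; exact: fourier_multiplier_cst.
  move=> x; rewrite normrM normfV (gtr0_norm M1) ler_pdivrMl// mulr1.
  by rewrite (le_trans (fM x))// (le_trans (ler_norm _))// lerDl.
split.
  have := Ff.1.1 measurableT `]-oo, 0[%classic.
  rewrite setTI; suff -> : f @^-1` `]-oo, 0[%classic = [set x | f x < 0] by apply.
  by apply/seteqP; split => x /=; rewrite in_itv.
(* The slope 1/4 keeps [y] inside the unit interval. *)
pose y x := 2^-1 + 4^-1 * f x.
pose g k x := (1 - y x ^+ k) ^+ (2 ^ k) * (1 - (1 - f x ^+ 2) ^+ k.+1).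
have yb x : 0 <= y x <= 1.
  by have := f1 x; rewrite ler_norml /y => ?; apply/andP; split; lra.
have f2b x : 0 <= 1 - f x ^+ 2 <= 1.
  rewrite subr_ge0 lerBlDr lerDl sqr_ge0 andbT.
  by rewrite -real_normK ?num_real// exprn_ile1.
have ub (z : R) k : 0 <= z <= 1 -> 0 <= 1 - z ^+ k <= 1.
  by move=> /andP[z0 z1]; rewrite subr_ge0 exprn_ile1//= lerBlDr lerDl exprn_ge0.
apply: (@fourier_multiplier_lim g _ 1).
- move=> k x; rewrite /g normrM; apply: mulr_ile1 => //.
    have /andP[h0 h1] := ub _ k (yb x).
    by rewrite ger0_norm ?exprn_ge0// exprn_ile1.
  by have /andP[h0 h1] := ub _ k.+1 (f2b x); rewrite ger0_norm.
- move=> x; have /ler_normlP[fN1 fp1] := f1 x.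
  have nz : f x != 0 -> (1 - (1 - f x ^+ 2) ^+ k.+1) @[k --> \oo] --> (1 : R).
    move=> fx0; rewrite -[X in _ --> X]subr0; apply: cvgB; first exact: cvg_cst.
    rewrite (cvg_shiftS (fun k => (1 - f x ^+ 2) ^+ k)).
    apply: cvg_exprn_lt1; have /andP[-> _] /= := f2b x.
    by rewrite ltrBlDr ltrDl exprn_even_gt0.
  rewrite indicE; have [fx0|fx0|fx0] := ltgtP (f x) 0.
  + rewrite mem_set//= -(mulr1 1); apply: cvgM.
      by apply: cvg_step_lt; rewrite /y; lra.
    by apply: nz; rewrite lt_eqF.
  + rewrite memNset/=; last by rewrite ltNge (ltW fx0).
    rewrite mulr0n -(mul0r 1); apply: cvgM.
      by apply: cvg_step_gt; rewrite /y; lra.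
    by apply: nz; rewrite gt_eqF.
  + rewrite memNset/=; last by rewrite fx0 ltxx.
    rewrite (_ : g ^~ x = cst 0); first exact: cvg_cst.
    by apply/funext => k; rewrite /g fx0 expr0n subr0 expr1n subrr mulr0.
- move=> k; apply: fourier_multiplierM.
    apply: fourier_multiplierX; apply: fourier_multiplier_oneB.
    apply: fourier_multiplierX; apply: fourier_multiplierD.
      exact: fourier_multiplier_cst.
    by apply: fourier_multiplierM => //; exact: fourier_multiplier_cst.
  apply: fourier_multiplier_oneB; apply: fourier_multiplierX.
  by apply: fourier_multiplier_oneB; exact: fourier_multiplierX.
Qed.

(** Each coordinate is a limit of multiples of sines, hence measurable for the
    sigma-algebra of Fourier sets; so that sigma-algebra contains the one
    generated by the coordinates. *)
Lemma fourier_set_measurable B : measurable B -> fourier_set B.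
Proof.
pose W := g_sigma_algebraType fourier_set.
have WE : (measurable : set (set W)) = fourier_set.
  by rewrite /measurable/= sigma_algebra_id//; exact: fourier_set_sigma_algebra.
have msin (s : V) : measurable_fun [set: W] (fun x : W => sin (dotv s x)).
  apply: (measurability _ (RGenInftyO.measurableE R)) => _ [_ [r ->] <-].
  rewrite setTI WE.
  have := @fourier_multiplier_lt0 (fun x => sin (dotv s x) + - r).
  rewrite (_ : [set x | _] = (fun x : W => sin (dotv s x)) @^-1` `]-oo, r[%classic).
    apply; apply: fourier_multiplierD; first exact: fourier_multiplier_sin.
    exact: fourier_multiplier_cst.
  by apply/seteqP; split => x /=; rewrite in_itv/= subr_lt0.
have mco i : measurable_fun [set: W] (fun x : W => x i ord0).
  pose e : V := delta_mx i ord0.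
  have eE (x : V) : dotv e x = x i ord0.
    rewrite dotvE (bigD1 i)//= mxE !eqxx mul1r big1 ?addr0// => j ji.
    by rewrite mxE (negbTE ji) mul0r.
  apply: (@measurable_fun_cvg _ _ R setT
    (fun k (x : W) => k.+1%:R * sin (dotv (k.+1%:R^-1 *: e) x))).
  - move=> k; apply: measurable_funM => //; exact: msin.
  - move=> x _ /=; rewrite -eE; under eq_fun do rewrite dotvZl.
    exact: cvg_sin_scaled.
move=> mB; rewrite -WE.
have := @measurable_fun_cV R _ W n (fun x => x) mco measurableT B mB.
by rewrite setTI.
Qed.

(** The indicator of a measurable set is a multiplier, and multiplying the
    constant density 1 by it and taking the frequency [t = 0] gives the measure
    of the set. *)
Lemma fourier_unique :
  (forall t : V, \int[mu]_x cos (dotv t x) = \int[nu]_x cos (dotv t x)) ->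
  (forall t : V, \int[mu]_x sin (dotv t x) = \int[nu]_x sin (dotv t x)) ->
  forall B : set V, measurable B -> mu B = nu B.
Proof.
move=> Hc Hs B mB.
have F1 : same_fourier (fun=> 1).
  split; first exact: bounded_mfun_cst.
  move=> t; split; under eq_Rintegral do rewrite mul1r;
    under [RHS]eq_Rintegral do rewrite mul1r; [exact: Hc | exact: Hs].
have [_ FB] := fourier_set_measurable mB.
have [bB /(_ 0)[+ _]] := FB.2 _ F1.
have E (m : {finite_measure set V -> \bar R}) :
    (\int[m]_x (\1_B x * 1 * cos (dotv 0 x)))%:E = m B.
  transitivity (\int[m]_x (\1_B x)%:E)%E; last by rewrite integral_indic// setIT.
  rewrite -bounded_mfun_EFin_Rintegral; last exact: bounded_mfun_indic.
  congr EFin; apply: eq_Rintegral => x _.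
  by rewrite -(scale0r x) dotvZl mul0r cos0 !mulr1.
by move=> h; rewrite -!E h.
Qed.

End characteristic_function_uniqueness.

(** * Lebesgue measure on column vectors *)

Section pushforward_measure.
Context d1 d2 (T1 : measurableType d1) (T2 : measurableType d2) (R : realType).

(** [pushforward m f] bundled as a measure for a map whose measurability is a
    separate proof rather than part of its type. *)
Definition pushforward_measure (m : {measure set T1 -> \bar R}) (f : T1 -> T2)
    (mf : measurable_fun setT f) : {measure set T2 -> \bar R} :=
  measure_function_pushforward__canonical__measure_function_Measure m mf.

End pushforward_measure.

Section lebesgue_vectors.
Context (R : realType).

Definition cons_cV n (p : R * 'cV[R]_n) : 'cV[R]_n.+1 :=
  col_mx (p.1%:M : 'cV[R]_1) p.2.

Definition uncons_cV n (v : 'cV[R]_n.+1) : R * 'cV[R]_n :=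
  (v ord0 ord0, @dsubmx R 1 n 1 v).

Lemma cons_cV0 n (p : R * 'cV[R]_n) : cons_cV p ord0 ord0 = p.1.
Proof.
rewrite /cons_cV (_ : ord0 = lshift n (ord0 : 'I_1)); last exact/val_inj.
by rewrite (@col_mxEu R 1 n 1) mxE eqxx.
Qed.

Lemma cons_cVS n (p : R * 'cV[R]_n) i : cons_cV p (lift ord0 i) ord0 = p.2 i ord0.
Proof.
rewrite /cons_cV (_ : lift ord0 i = rshift 1 i); last exact/val_inj.
by rewrite (@col_mxEd R 1 n 1).
Qed.

Lemma cons_cVK n : cancel (@cons_cV n) (@uncons_cV n).
Proof.
by move=> p; rewrite /uncons_cV cons_cV0 /cons_cV col_mxKd; case: p.
Qed.

Lemma uncons_cVK n : cancel (@uncons_cV n) (@cons_cV n).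
Proof.
move=> v; apply/matrixP => i j; rewrite ord1 {j}.
have [->|i0] := eqVneq i ord0; first by rewrite cons_cV0.
have /unlift_some[k -> _] : ord0 != i by rewrite eq_sym.
rewrite cons_cVS mxE; congr (v _ _); exact/val_inj.
Qed.

Lemma measurable_cons_cV n : measurable_fun setT (@cons_cV n).
Proof.
apply: measurable_fun_cV => i.
have [->|i0] := eqVneq i ord0.
  by under eq_fun do rewrite cons_cV0; exact: measurable_fst.
have /unlift_some[k -> _] : ord0 != i by rewrite eq_sym.
under eq_fun do rewrite cons_cVS.
exact: measurableT_comp (measurable_coord k) measurable_snd.
Qed.

Lemma measurable_uncons_cV n : measurable_fun setT (@uncons_cV n).
Proof.
apply/measurable_fun_pairP; split; first exact: measurable_coord.
apply: measurable_fun_cV => i.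
have -> : (fun w => (snd \o @uncons_cV n) w i ord0) =
    (fun w : 'cV[R]_n.+1 => w (rshift 1 i) ord0).
  by apply/funext => w /=; rewrite mxE.
exact: measurable_coord.
Qed.

Lemma measurable_section_cV n (B : set 'cV[R]_n.+1) x : measurable B ->
  measurable [set v | B (cons_cV (x, v))].
Proof.
move=> mB; have := measurable_xsection x (measurable_cons_cV measurableT mB).
rewrite setTI; congr measurable.
by apply/seteqP; split => v; rewrite /xsection/= inE.
Qed.

(** [lebesgue_cV] iterates integrals of sections, which on measurable sets is
    the product of the one-dimensional measure with the previous one,
    transported by [cons_cV]; sigma-finiteness is carried along since the next
    product needs it. *)
Lemma lebesgue_cV_measure n : exists m : {sigma_finite_measure set 'cV[R]_n -> \bar R},
  forall B, measurable B -> lebesgue_cV B = m B.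
Proof.
elim: n => [|n [m mE]]; first by exists (dirac (0 : 'cV[R]_0)).
pose l : {measure set 'cV[R]_n.+1 -> \bar R} :=
  pushforward_measure (@lebesgue_measure R \x m)%E (@measurable_cons_cV n).
have sf : sigma_finite setT l.
  have /sigma_finiteP[F [FT ndF mF]] := sigma_finiteT (@lebesgue_measure R).
  have /sigma_finiteP[G [GT ndG mG]] := sigma_finiteT m.
  exists (fun k => @uncons_cV n @^-1` (F k `*` G k)).
    apply/seteqP; split => // v _.
    have [i _ Fi] : (\bigcup_k F k) (uncons_cV v).1 by rewrite -FT.
    have [j _ Gj] : (\bigcup_k G k) (uncons_cV v).2 by rewrite -GT.
    exists (maxn i j) => //; split.
      by move: Fi; exact/subsetPset/ndF/leq_maxl.
    by move: Gj; exact/subsetPset/ndG/leq_maxr.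
  move=> k; have [mFk Fkoo] := mF k; have [mGk Gkoo] := mG k; split.
    rewrite -[X in measurable X]setTI; apply: measurable_uncons_cV => //.
    exact: measurableX.
  rewrite /l/= /pushforward -comp_preimage.
  rewrite (_ : _ \o _ = id); last by apply/funext => p /=; rewrite cons_cVK.
  by rewrite preimage_id product_measure1E// lte_mul_pinfty// ge0_fin_numE.
pose ls : {sigma_finite_measure set 'cV[R]_n.+1 -> \bar R} :=
  HB.pack (l : set _ -> \bar R) (Measure.on l) (@Measure_isSigmaFinite.Build _ _ _ l sf).
exists ls => B mB.
rewrite /ls/= /l/= /pushforward /product_measure1/=.
apply: eq_integral => x _; rewrite mE.
  by congr (m _); apply/seteqP; split => v; rewrite /xsection/= inE.
exact: measurable_section_cV.
Qed.

Definition lebV n : {sigma_finite_measure set 'cV[R]_n -> \bar R} :=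
  sval (cid (@lebesgue_cV_measure n)).

Lemma lebVE n (B : set 'cV[R]_n) : measurable B -> lebesgue_cV B = lebV n B.
Proof. by rewrite /lebV; case: cid => m mE /=; exact: mE. Qed.

Lemma lebVS n (B : set 'cV[R]_n.+1) : measurable B ->
  lebV n.+1 B =
  (\int[@lebesgue_measure R]_x lebV n [set v | B (cons_cV (x, v))])%E.
Proof.
move=> mB; rewrite -lebVE//=; apply: eq_integral => x _; apply: lebVE.
exact: measurable_section_cV.
Qed.

Lemma measurable_lebV_section n (B : set 'cV[R]_n.+1) : measurable B ->
  measurable_fun setT (fun x => lebV n [set v | B (cons_cV (x, v))]).
Proof.
move=> mB; have := measurable_cons_cV measurableT mB; rewrite setTI => mcB.
have := measurable_fun_xsection (lebV n) mcB.
congr measurable_fun; apply/funext => x /=; congr (lebV n _).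
by apply/seteqP; split => v; rewrite /xsection/= inE.
Qed.

Lemma measurable_box n (I : set R) : measurable I ->
  measurable [set v : 'cV[R]_n | forall i, I (v i ord0)].
Proof.
move=> mI.
rewrite (_ : [set v | _] =
    \bigcap_(i in [set: 'I_n]) [set v : 'cV[R]_n | I (v i ord0)]).
  apply: fin_bigcap_measurable => // i _.
  by have := measurable_coord i measurableT mI; rewrite setTI.
by apply/seteqP; split => v /= h i; [move=> _|]; exact: h.
Qed.

Lemma lebV_box n (I : set R) : measurable I ->
  lebV n [set v : 'cV[R]_n | forall i, I (v i ord0)] =
    (@lebesgue_measure R I ^+ n)%E.
Proof.
move=> mI; have mbox k := @measurable_box k I mI.
elim: n => [|n IH].
  rewrite -lebVE//= diracE mem_set//=.
  by case.
rewrite lebVS//; transitivity (\int[@lebesgue_measure R]_x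
    ((\1_I x)%:E * (@lebesgue_measure R I ^+ n)))%E; last first.
  rewrite ge0_integralZr//; first by rewrite integral_indic// setIT -expeS.
  - exact/measurable_EFinP/measurable_indic.
  - by apply: expe_ge0.
apply: eq_integral => x _; rewrite indicE; have [Ix|nIx] := pselect (I x).
  rewrite mem_set// mul1e -IH; congr (lebV n _); apply/seteqP; split => v /= h i.
    by have := h (lift ord0 i); rewrite cons_cVS.
  have [->|i0] := eqVneq i ord0; first by rewrite cons_cV0.
  have /unlift_some[k -> _] : ord0 != i by rewrite eq_sym.
  by rewrite cons_cVS; exact: h.
rewrite memNset// mul0e (_ : [set v | _] = set0) ?measure0//.
by apply/seteqP; split => v //= /(_ ord0); rewrite cons_cV0.
Qed.

Lemma lebesgue_measure_shift (a : R) (A : set R) : measurable A ->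
  lebesgue_measure ((fun x => x + a) @^-1` A) = lebesgue_measure A.
Proof.
move=> mA.
have ms : measurable_fun setT ((fun x => x + a) : R -> measurableTypeR R).
  exact: measurable_funD.
apply/esym.
apply: (@lebesgue_measure_unique R (@pushforward_measure _ _
  (measurableTypeR R) (measurableTypeR R) R (@lebesgue_measure R) _ ms)) => //.
move=> _ [[b c]] _ <-.
transitivity (lebesgue_measure `]b - a, c - a]%classic); last first.
  congr lebesgue_measure; by apply/seteqP; split => x /=; rewrite !in_itv/= ltrBlDr lerBrDr.
rewrite !lebesgue_measure_itv/= !lte_fin ltrD2r.
by case: ifP => // _; rewrite -!EFinB; congr EFin; ring.
Qed.

(** Shift the tail of the vector inside each section by induction, and the first
    coordinate in the outer integral by [lebesgue_measure_shift]. *)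
Lemma lebV_shift n (a : 'cV[R]_n) (B : set 'cV[R]_n) : measurable B ->
  lebV n [set v | B (v + a)] = lebV n B.
Proof.
elim: n a B => [|n IH] a B mB.
  congr (lebV 0 _); apply/seteqP; split => v /=;
    by rewrite (_ : v + a = v)//; apply/matrixP => -[].
have mBa k (c : 'cV[R]_k) (C : set 'cV[R]_k) : measurable C ->
    measurable [set v | C (v + c)].
  move=> mC.
  have /(_ measurableT C mC) := measurable_addcV (@measurable_id _ 'cV[R]_k setT) (@measurable_cst _ _ _ _ setT c).
  by rewrite setTI.
have mBx x : measurable [set v | B (cons_cV (x, v))].
  exact: measurable_section_cV.
rewrite lebVS//; last exact: mBa.
pose g x := lebV n [set v | B (cons_cV (x, v))].
have consD x v : cons_cV (x, v) + a = cons_cV (x + a ord0 ord0, v + @dsubmx R 1 n 1 a).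
  rewrite -[a in LHS]uncons_cVK; apply/matrixP => i j; rewrite ord1 {j} mxE.
  have [->|i0] := eqVneq i ord0; first by rewrite !cons_cV0.
  have /unlift_some[k -> _] : ord0 != i by rewrite eq_sym.
  by rewrite !cons_cVS [RHS]mxE.
under eq_integral => x _.
  under eq_set do rewrite /= consD.
  rewrite (IH (@dsubmx R 1 n 1 a) [set v | B (cons_cV (x + a ord0 ord0, v))])//.
  over.
rewrite lebVS//.
have ms : measurable_fun setT ((fun x => x + a ord0 ord0) : R -> measurableTypeR R).
  exact: measurable_funD.
have := @ge0_integral_pushforward _ _ (measurableTypeR R) (measurableTypeR R) R _ ms (@lebesgue_measure R) setT g measurableT
  (measurable_lebV_section mB) (fun _ _ => measure_ge0 _ _).
rewrite preimage_setT => <-.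
apply: eq_measure_integral => A mA _; exact: lebesgue_measure_shift.
Qed.

End lebesgue_vectors.

(** * Invariance under orthogonal maps *)

Lemma mule_pcancel (R : realType) (b x y : \bar R) :
  b \is a fin_num -> (0 < b)%E -> (b * x = b * y)%E -> x = y.
Proof.
move=> bfin b0 h.
by apply/eqP; rewrite eq_le -(lee_pmul2l bfin b0) h lexx -(lee_pmul2l bfin b0) h lexx.
Qed.

Section orthogonal_invariance.
Context (R : realType) (n : nat).
Implicit Types (v w x y : 'cV[R]_n) (H : 'M[R]_n) (B F : set 'cV[R]_n).

Lemma orthogonal_trmx H : H^T *m H = 1%:M -> H *m H^T = 1%:M.
Proof. exact: mulmx1C. Qed.

Lemma enorm_orthogonal H v : H^T *m H = 1%:M -> enorm (H *m v) = enorm v.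
Proof. by move=> HH; rewrite !enormE dotv_mulmxr mulmxA HH mul1mx. Qed.

(** The origin is removed because the cone over the whole sphere omits it. *)
Definition punctured_ball : set 'cV[R]_n := [set v | 0 < enorm v <= 1].

Lemma measurable_punctured_ball : measurable punctured_ball.
Proof.
rewrite (_ : punctured_ball = (@enorm R n) @^-1` `]0, 1]%classic).
  apply: measurable_preimageT => //.
  exact: (@measurable_enorm R _ _ n id (@measurable_id _ _ _)).
by apply/seteqP; split => v /=; rewrite in_itv.
Qed.

Lemma ler_coord_enorm v i : `|v i ord0| <= enorm v.
Proof.
rewrite -sqrtr_sqr /enorm ler_wsqrtr// (bigD1 i)//= lerDl sumr_ge0// => j _.
exact: sqr_ge0.
Qed.

Lemma lebV_punctured_ball_lty : (lebV R n punctured_ball < +oo)%E.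
Proof.
have mI : measurable (`[(-1 : R), 1]%classic : set R) by [].
have mbox := @measurable_box R n _ mI.
have boxE := lebV_box n mI.
apply: (@le_lt_trans _ _ (lebV R n [set v | forall i, `[(-1 : R), 1]%classic (v i ord0)])).
  apply: le_measure; rewrite ?inE//; first exact: measurable_punctured_ball.
  move=> v /andP[_ v1] i /=; rewrite in_itv/= -ler_norml.
  exact: le_trans (ler_coord_enorm v i) v1.
have N11 : (-1 : R) < 1 by lra.
rewrite boxE lebesgue_measure_itv/= lte_fin N11 -EFinB -EFin_expe.
by rewrite ltry.
Qed.

Lemma lebV_punctured_ball_gt0 : (0 < n)%N -> (0 < lebV R n punctured_ball)%E.
Proof.
move=> n0.
(* A vector of the box with sides ]0, 1/n] has squared norm at most n / n ^ 2. *)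
pose e : R := n%:R^-1.
have e0 : 0 < e by rewrite invr_gt0 ltr0n.
have e1 : e <= 1 by rewrite invf_le1 ?ltr0n// ler1n.
have mI : measurable (`](0 : R), e]%classic : set R) by [].
have mbox := @measurable_box R n _ mI.
have boxE := lebV_box n mI.
apply: (@lt_le_trans _ _ (lebV R n [set v | forall i, `](0 : R), e]%classic (v i ord0)])).
  rewrite boxE lebesgue_measure_itv/= lte_fin e0 sube0 -EFin_expe lte_fin.
  exact: exprn_gt0.
apply: le_measure; rewrite ?inE//; first exact: measurable_punctured_ball.
move=> v /= vI; apply/andP; split.
  apply: enorm_gt0; apply/eqP => v0.
  by have := vI (Ordinal n0); rewrite v0 mxE in_itv/= ltxx.
rewrite -sqrtr1 /enorm ler_wsqrtr//.
apply: (@le_trans _ _ (\sum_(i < n) e ^+ 2)).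
  apply: ler_sum => i _; have := vI i; rewrite in_itv/= => /andP[v0 v1].
  by rewrite lerXn2r// nnegrE ltW.
rewrite sumr_const card_ord -[leRHS]mulr1 -mulr_natl expr2 mulrA.
by rewrite mulfV ?mul1r ?mulr1// pnatr_eq0 -lt0n.
Qed.

Lemma integral_section_swap (E : set ('cV[R]_n * 'cV[R]_n)) : measurable E ->
  (\int[lebV R n]_x lebV R n [set y | E (x, y)] =
   \int[lebV R n]_y lebV R n [set x | E (x, y)])%E.
Proof.
move=> mE.
transitivity ((lebV R n \x lebV R n)%E E).
  apply: eq_integral => x _ /=; congr (lebV R n _).
  by apply/seteqP; split => y; rewrite /xsection/= inE.
rewrite (@product_measure_unique _ _ _ _ _ _ _ (lebV R n \x^ lebV R n)%E)//.
  apply: eq_integral => y _ /=; congr (lebV R n _).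
  by apply/seteqP; split => x; rewrite /ysection/= inE.
by move=> A1 A2 mA1 mA2; exact: product_measure2E.
Qed.

(** The usual proof that a translation-invariant measure is unique, with the
    image of Lebesgue measure under [H] in the role of the second measure.
    Let [B] be the punctured ball and integrate the indicator of
    [B x /\ F (x + H y)] over [x] and [y].  Integrating first in [y] gives
    the measure of [B] times that of the preimage of [F], by invariance under
    the shift [H^T x].  Translating [x] by [- H y] and integrating first in the
    new [y] gives the measure of [F] times that of [B], because [B] is
    symmetric and stable under [H].  The measure of [B] is positive and finite,
    so it cancels; no determinant is computed. *)
Lemma lebV_orthogonal H F : (0 < n)%N -> H^T *m H = 1%:M -> measurable F ->
  lebV R n [set v | F (H *m v)] = lebV R n F.
Proof.
move=> n0 HH mF; pose B := punctured_ball.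
have mB : measurable B := measurable_punctured_ball.
have HHt := orthogonal_trmx HH.
have mH : measurable_fun setT (fun v => H *m v).
  exact: (@measurable_mulmx R _ _ n n H id (@measurable_id _ _ _)).
have mHF : measurable [set v | F (H *m v)] by exact: measurable_preimageT mH mF.
have slice A C : measurable A -> measurable C ->
    (\int[lebV R n]_x ((\1_A x)%:E * lebV R n C))%E = (lebV R n A * lebV R n C)%E.
  move=> mA mC; rewrite ge0_integralZr//; first by rewrite integral_indic// setIT.
  exact/measurable_EFinP/measurable_indic.
have sliceE (A : set 'cV[R]_n) (D : 'cV[R]_n -> set 'cV[R]_n) (C : set 'cV[R]_n) :
    (forall x, lebV R n (D x) = lebV R n C) ->
    forall x, lebV R n [set y | A x /\ D x y] = ((\1_A x)%:E * lebV R n C)%E.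
  move=> DC x; rewrite indicE; have [Ax|nAx] := pselect (A x).
    rewrite mem_set// mul1e -(DC x); congr (lebV R n _).
    by apply/seteqP; split => y /= => [[]|].
  rewrite memNset// mul0e (_ : [set y | _] = set0) ?measure0//.
  by apply/seteqP; split => y //= -[].
have m1 : measurable_fun setT (fun p : 'cV[R]_n * 'cV[R]_n => p.1 + H *m p.2).
  apply: measurable_addcV; first exact: measurable_fst.
  by apply: measurable_mulmx; exact: measurable_snd.
have m2 : measurable_fun setT (fun p : 'cV[R]_n * 'cV[R]_n => p.1 + - H *m p.2).
  apply: measurable_addcV; first exact: measurable_fst.
  by apply: measurable_mulmx; exact: measurable_snd.
suff : (lebV R n B * lebV R n [set v | F (H *m v)] = lebV R n B * lebV R n F)%E.
  have B0 := lebV_punctured_ball_gt0 n0; have Boo := lebV_punctured_ball_lty.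
  have Bfin : lebV R n B \is a fin_num by rewrite ge0_fin_numE.
  exact: mule_pcancel Bfin B0.
transitivity (\int[lebV R n]_x lebV R n [set y | B x /\ F (x + H *m y)%R])%E.
  rewrite -slice//; apply: eq_integral => x _.
  apply/esym; apply: (sliceE B (fun x => [set y | F (x + H *m y)])) => {}x.
  rewrite -(lebV_shift (H^T *m x) mHF); congr (lebV R n _).
  by apply/seteqP; split => y /=; rewrite mulmxDr mulmxA HHt mul1mx addrC.
rewrite (@integral_section_swap [set p | B p.1 /\ F (p.1 + H *m p.2)]); last first.
  apply: measurableI; first exact: (measurable_preimageT measurable_fst mB).
  exact: (measurable_preimageT m1 mF).
transitivity (\int[lebV R n]_y lebV R n [set x | F x /\ B (x + - H *m y)%R])%E.
  apply: eq_integral => y _ /=.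
  rewrite -(@lebV_shift R n (H *m y) [set x | F x /\ B (x + - H *m y)]).
    congr (lebV R n _); apply/seteqP; split => x /=;
      by rewrite mulNmx addrK => -[].
  apply: measurableI => //; apply: measurable_preimageT mB.
  by apply: measurable_addcV => //; exact: measurable_id.
rewrite -(@integral_section_swap [set p | F p.1 /\ B (p.1 + - H *m p.2)]); last first.
  apply: measurableI; first exact: (measurable_preimageT measurable_fst mF).
  exact: (measurable_preimageT m2 mB).
rewrite muleC -slice//; apply: eq_integral => x _.
apply: (sliceE F (fun x => [set y | B (x + - H *m y)])) => {}x.
rewrite -(lebV_shift (- (H^T *m x)) mB); congr (lebV R n _).
suff e y : enorm (x + - H *m y) = enorm (y - H^T *m x).
  by apply/seteqP; split => y /=; rewrite /B /punctured_ball/= e.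
rewrite -(enorm_orthogonal (y - H^T *m x) HH) mulmxBr mulmxA HHt mul1mx.
by rewrite mulNmx -[RHS]mul1r -normrN1 -enormZ scaleN1r opprB.
Qed.

(** The reflection along [v - w]. *)
Lemma householder v w : dotv v v = dotv w w ->
  exists2 H : 'M[R]_n, H^T *m H = 1%:M & H *m v = w.
Proof.
move=> vw; have [->|nvw] := eqVneq v w.
  by exists 1%:M; rewrite ?trmx1 ?mul1mx.
pose u := v - w; pose c : R := 2 / dotv u u.
have u0 : dotv u u != 0.
  apply: contraNneq nvw => /dotvv_eq0/eqP; rewrite subr_eq0; by move/eqP => ->.
have ut x : u^T *m x = (dotv u x)%:M by rewrite [LHS]mx11_scalar.
pose K : 'M[R]_n := u *m u^T.
have Kt : K^T = K by rewrite /K trmx_mul trmxK.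
have KK : K *m K = dotv u u *: K.
  by rewrite /K mulmxA -(mulmxA u) ut mul_mx_scalar -scalemxAl.
exists (1%:M - c *: K).
  have -> : (1%:M - c *: K)^T = 1%:M - c *: K.
    have trB (X : 'M[R]_n) : (1%:M - c *: X)^T = 1%:M - c *: X^T.
      by apply/matrixP => i j; rewrite !mxE eq_sym.
    by rewrite trB Kt.
  rewrite mulmxBl mul1mx mulmxBr mulmx1.
  rewrite -scalemxAl -scalemxAr KK !scalerA.
  have -> : c * c * dotv u u = c + c by rewrite /c; field.
  by rewrite scalerDl opprB addrK subrK.
rewrite mulmxBl mul1mx -scalemxAl /K -mulmxA ut mul_mx_scalar scalerA.
have -> : c * dotv u v = 1.
  have uu : dotv u u = 2 * dotv u v.
    rewrite /u !(dotvDl, dotvDr, dotvNr, dotvNl) -vw (dotvC w v); ring.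
  by rewrite /c uu; move: u0; rewrite uu mulf_eq0 negb_or => /andP[_ ?]; field.
by rewrite scale1r /u opprB addrC subrK.
Qed.

End orthogonal_invariance.

(** * The uniform distribution on the sphere *)

Section sphere.
Context (R : realType) (n : nat).
Hypothesis n0 : (0 < n)%N.
Implicit Types (v w : 'cV[R]_n) (H : 'M[R]_n) (B : set 'cV[R]_n).
Local Notation ball1 := (@punctured_ball R n).
Local Notation leb := (lebV R n).

(** At the origin the value is 0; the origin is never in the punctured ball. *)
Definition unit_dir v : 'cV[R]_n := (enorm v)^-1 *: v.

Lemma measurable_unit_dir : measurable_fun setT unit_dir.
Proof.
have mid : measurable_fun setT (fun v : 'cV[R]_n => v) by exact: measurable_id.
apply: measurable_scalecV => //.
have -> : (fun v : 'cV[R]_n => (enorm v)^-1) = (fun v => enorm v `^ (-1)).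
  by apply/funext => v; rewrite powR_inv1// enorm_ge0.
have h := measurableT_comp (measurable_powR (-1 : R)) (measurable_enorm mid).
exact h.
Qed.

Lemma enorm_unit_dir v : v != 0 -> enorm (unit_dir v) = 1.
Proof.
move=> v0; have := enorm_gt0 v0 => ev0.
by rewrite enormZ gtr0_norm ?invr_gt0// mulVf// gt_eqF.
Qed.

Lemma punctured_ball_neq0 v : ball1 v -> v != 0.
Proof. by move=> /andP[+ _]; apply: contraTneq => ->; rewrite enorm0 ltxx. Qed.

(** A nonzero vector is its norm times its direction, so surface measure is the
    image under [unit_dir] of Lebesgue measure restricted to the punctured
    ball.  This makes it countably additive and invariant under orthogonal
    maps. *)
Lemma cone_sphere B : cone (B `&` @usphere R n) = ball1 `&` unit_dir @^-1` B.
Proof.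
apply/seteqP; split => [v [r [w [/andP[r0 r1]]]]|v [vball Bv]].
  rewrite inE => -[Bw w1] ->.
  have e : enorm (r *: w) = r by rewrite enormZ w1 mulr1 gtr0_norm.
  split; first by rewrite /punctured_ball/= e r0 r1.
  by rewrite /= /unit_dir e scalerA mulVf ?scale1r// gt_eqF.
exists (enorm v), (unit_dir v); split => //.
  rewrite inE; split => //; exact/enorm_unit_dir/punctured_ball_neq0.
rewrite /unit_dir scalerA mulfV ?scale1r// gt_eqF//.
by case/andP: vball.
Qed.

Lemma measurable_cone_sphere B : measurable B ->
  measurable (cone (B `&` @usphere R n)).
Proof.
move=> mB; rewrite cone_sphere; apply: measurableI.
  exact: measurable_punctured_ball.
exact: measurable_preimageT measurable_unit_dir mB.
Qed.

Lemma sphere_areaE B : measurable B ->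
  sphere_area B = (n%:R%:E * leb (ball1 `&` unit_dir @^-1` B))%E.
Proof.
move=> mB; rewrite /sphere_area lebVE; last exact: measurable_cone_sphere.
by rewrite cone_sphere.
Qed.

Lemma sphere_area_orthogonal H B : H^T *m H = 1%:M -> measurable B ->
  sphere_area [set v | B (H *m v)] = sphere_area B.
Proof.
move=> HH mB.
have mH : measurable_fun setT (fun v : 'cV[R]_n => H *m v).
  by apply: measurable_mulmx; exact: measurable_id.
have mHB : measurable [set v | B (H *m v)] by exact: measurable_preimageT mH mB.
rewrite !sphere_areaE//; congr (_ * _)%E.
rewrite -[RHS](lebV_orthogonal n0 HH); last first.
  by rewrite -cone_sphere; exact: measurable_cone_sphere.
congr (leb _); apply/seteqP; split => v /=;
  by rewrite /punctured_ball/= /unit_dir enorm_orthogonal// -scalemxAr.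
Qed.

Lemma measurable_usphere : measurable (@usphere R n).
Proof.
rewrite (_ : @usphere R n = (@enorm R n) @^-1` [set 1]); last first.
  by apply/seteqP; split.
apply: measurable_preimageT => //.
exact: (@measurable_enorm R _ _ n id (@measurable_id _ _ _)).
Qed.

Lemma sphere_area_usphere : sphere_area (@usphere R n) = sphere_area [set: 'cV[R]_n].
Proof. by rewrite /sphere_area setIid setTI. Qed.

Lemma uniform_sphere_probability : exists s : probability 'cV[R]_n R,
  forall B, measurable B -> s B = (sphere_area B / sphere_area [set: 'cV[R]_n])%E.
Proof.
pose m : {measure set 'cV[R]_n -> \bar R} :=
  pushforward_measure (mrestr leb (@measurable_punctured_ball R n)) measurable_unit_dir.
have mE B : m B = leb (ball1 `&` unit_dir @^-1` B).
  by rewrite /m/= /pushforward /mrestr setIC.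
have mTE : m setT = leb ball1 by rewrite mE preimage_setT setIT.
have B0 := lebV_punctured_ball_gt0 R n0; have Boo := lebV_punctured_ball_lty R n.
have Bfin : leb ball1 \is a fin_num by rewrite ge0_fin_numE.
exists (mnormalize m (dirac (0 : 'cV[R]_n)) : probability _ _) => B mB.
have nE : mnormalize m (dirac (0 : 'cV[R]_n)) B = (m B * (fine (leb ball1))^-1%:E)%E.
  by rewrite /mnormalize mTE (gt_eqF B0) (lt_eqF Boo).
transitivity (m B * (fine (leb ball1))^-1%:E)%E; first exact: nE.
rewrite !sphere_areaE// mE.
rewrite preimage_setT setIT.
set c := leb ball1 in B0 Boo Bfin *; set a := leb _.
have aoo : (a < +oo)%E.
  apply: le_lt_trans Boo; apply: le_measure; rewrite ?inE.
  - rewrite -cone_sphere; exact: measurable_cone_sphere.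
  - exact: measurable_punctured_ball.
  - by move=> v [].
have afin : a \is a fin_num by rewrite ge0_fin_numE// measure_ge0.
rewrite -(fineK afin) -(fineK Bfin) -!EFinM.
have c0 : 0 < fine c by rewrite fine_gt0// B0 Boo.
have nR0 : n%:R != 0 :> R by rewrite pnatr_eq0 -lt0n.
have nc0 : n%:R * fine c != 0 by rewrite mulf_neq0// gt_eqF.
rewrite inver (negbTE nc0) -EFinM /=; congr EFin.
by field; rewrite nR0 gt_eqF.
Qed.

End sphere.

(** * Integrals of trigonometric functions of random vectors *)

Section Rintegral_transfer.
Context d1 d2 (T1 : measurableType d1) (T2 : measurableType d2) (R : realType).

(** The measure [m] only has to agree with the image of [P] on measurable sets,
    which is all that equality in distribution provides. *)
Lemma Rintegral_pushforward (P : {finite_measure set T1 -> \bar R})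
    (m : {measure set T2 -> \bar R}) (h : T1 -> T2) (f : T2 -> R) :
  measurable_fun setT h -> bounded_mfun f ->
  (forall B, measurable B -> m B = P (h @^-1` B)) ->
  \int[m]_y f y = \int[P]_x f (h x).
Proof.
move=> mh bf mE; rewrite /Rintegral.
rewrite (eq_measure_integral (pushforward_measure P mh)); last first.
  by move=> B mB _; rewrite mE.
congr fine; rewrite [LHS]integral_pushforward//.
- exact/measurable_EFinP/bf.1.
- rewrite preimage_setT; apply: bounded_mfun_integrable.
  exact: bounded_mfun_comp mh bf.
Qed.

Definition product_probability (P : probability T1 R) (Q : probability T2 R) :
  probability (T1 * T2)%type R := (P \x Q)%E.

Lemma Rintegral_Fubini (P : probability T1 R) (Q : probability T2 R)
    (f : T1 * T2 -> R) : bounded_mfun f ->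
  \int[product_probability P Q]_p f p = \int[P]_x \int[Q]_y f (x, y) /\
  \int[product_probability P Q]_p f p = \int[Q]_y \int[P]_x f (x, y).
Proof.
move=> bf.
have bx x : bounded_mfun (fun y => f (x, y)).
  exact: bounded_mfun_comp (pair1_measurable x) bf.
have bfy y : bounded_mfun (fun x => f (x, y)).
  exact: bounded_mfun_comp (pair2_measurable y) bf.
have fi := bounded_mfun_integrable (product_probability P Q) bf.
split; congr fine.
- rewrite -integral12_prod_meas1//; apply: eq_integral => x _.
  by rewrite bounded_mfun_EFin_Rintegral.
- rewrite -integral21_prod_meas1//; apply: eq_integral => y _.
  by rewrite bounded_mfun_EFin_Rintegral.
Qed.

Lemma measurable_Rintegral2 (P : probability T1 R) (Q : probability T2 R)
    (f : T1 * T2 -> R) : bounded_mfun f ->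
  measurable_fun setT (fun y => \int[P]_x f (x, y)).
Proof.
move=> bf; apply/measurable_EFinP.
have fi := bounded_mfun_integrable (product_probability P Q) bf.
have := measurable_fubini_G fi; congr measurable_fun; apply/funext => y /=.
rewrite bounded_mfun_EFin_Rintegral//.
exact: bounded_mfun_comp (pair2_measurable y) bf.
Qed.

Lemma Rintegral_full_set (P : probability T1 R) (A : set T1) (f : T1 -> R) (c : R) :
  measurable A -> P A = 1%E -> measurable_fun setT f ->
  (forall x, A x -> f x = c) -> \int[P]_x f x = c.
Proof.
move=> mA PA mf fc; transitivity (\int[P]_x c); last first.
  rewrite Rintegral_cst// -[RHS]mulr1; congr (c * _).
  exact: (congr1 (@fine R) (probability_setT P)).
congr fine; apply: ae_eq_integral => //.
- exact/measurable_EFinP.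
- exists (~` A); split; first exact: measurableC.
    transitivity (1 - P A)%E; first exact: probability_setC.
    by rewrite PA subee.
  by move=> x /=; apply: contra_not => Ax _; rewrite fc.
Qed.

End Rintegral_transfer.

Section rotation_invariant.
Context (R : realType) (n : nat) (s : {finite_measure set 'cV[R]_n -> \bar R}).
Hypothesis s_inv : forall H : 'M[R]_n, H^T *m H = 1%:M ->
  forall B, measurable B -> s [set v | B (H *m v)] = s B.

(** Some reflection takes [w] to [v], and it preserves [s]. *)
Lemma rotation_invariant_cos (v w : 'cV[R]_n) : dotv v v = dotv w w ->
  \int[s]_x cos (dotv v x) = \int[s]_x cos (dotv w x).
Proof.
move=> /esym/householder[H HH <-].
have HHt : H^T^T *m H^T = 1%:M by rewrite trmxK; exact: orthogonal_trmx.
rewrite (@Rintegral_pushforward _ _ _ _ R s s (fun x => H *m x) (fun x => cos (dotv (H *m w) x))).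
- by apply: eq_Rintegral => x _; rewrite dotv_mulmxr mulmxA HH mul1mx.
- by apply: measurable_mulmx; exact: measurable_id.
- by apply: bounded_mfun_cos; exact: measurable_dotv.
- by move=> B mB; rewrite -[LHS](s_inv HH mB).
Qed.

(** Reflection through the origin preserves [s] and changes the sign of
    [sin]. *)
Lemma rotation_invariant_sin (v : 'cV[R]_n) : \int[s]_x sin (dotv v x) = 0.
Proof.
have N1 : (- 1%:M : 'M[R]_n)^T *m (- 1%:M) = 1%:M.
  have -> : (- 1%:M : 'M[R]_n)^T = - 1%:M.
    by apply/matrixP => i j; rewrite !mxE eq_sym.
  by rewrite mulNmx mulmxN opprK mul1mx.
have bs : bounded_mfun (fun x => sin (dotv v x)).
  by apply: bounded_mfun_sin; exact: measurable_dotv.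
have : \int[s]_x sin (dotv v x) = - \int[s]_x sin (dotv v x).
  rewrite {1}(@Rintegral_pushforward _ _ _ _ R s s (fun x => - 1%:M *m x)
    (fun x => sin (dotv v x)))//.
  - transitivity (\int[s]_x (-1 * sin (dotv v x))); last first.
      by rewrite RintegralZl ?mulN1r//; exact: bounded_mfun_integrable.
    by apply: eq_Rintegral => x _; rewrite mulNmx mul1mx dotvNr sinN mulN1r.
  - by apply: measurable_mulmx; exact: measurable_id.
  - by move=> B mB; rewrite -[LHS](s_inv N1 mB).
by lra.
Qed.

End rotation_invariant.

(** * Elliptical distributions *)

Section elliptical.
Context (R : realType).

(** Real and imaginary parts of the defining identity. *)
Lemma RESP d (T : measurableType d) (P : probability T R) (n : nat)
    (X : {RV P >-> 'cV[R]_n}) (mu : 'cV[R]_n) (S : 'M[R]_n) (phi : R -> R) :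
  RES X mu S phi <-> sym_psd S /\ forall t,
    \int[P]_w cos (dotv t (X w)) = cos (dotv t mu) * phi (qform S t) /\
    \int[P]_w sin (dotv t (X w)) = sin (dotv t mu) * phi (qform S t).
Proof.
split=> -[psd h]; split=> // t.
  have := h t; rewrite /char_fun /complex_expectation /expi /=.
  move=> /eqP; rewrite eq_complex /= !mulr0 subr0 add0r => /andP[/eqP -> /eqP ->].
  by [].
have [hc hs] := h t.
rewrite /char_fun /complex_expectation /expi /= hc hs.
by apply/eqP; rewrite eq_complex /= !mulr0 subr0 add0r !eqxx.
Qed.

Lemma qform_mulmx_trmx m k (A : 'M[R]_(m, k)) (t : 'cV[R]_m) :
  qform (A *m A^T) t = dotv (A^T *m t) (A^T *m t).
Proof. by rewrite /qform /dotv trmx_mul trmxK !mulmxA. Qed.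

Lemma uniform_on_sphere_orthogonal d (T : measurableType d)
    (P : probability T R) (n : nat) (u : {RV P >-> 'cV[R]_n}) :
  (0 < n)%N -> uniform_on_sphere u ->
  forall H : 'M[R]_n, H^T *m H = 1%:M -> forall B, measurable B ->
    distribution P u [set v | B (H *m v)] = distribution P u B.
Proof.
move=> n0 uu H HH B mB; rewrite !uu//; last first.
  apply: measurable_preimageT mB.
  by apply: measurable_mulmx; exact: measurable_id.
by rewrite sphere_area_orthogonal.
Qed.

Lemma Rintegral_independent d d1 d2 (T : measurableType d)
    (T1 : measurableType d1) (T2 : measurableType d2) (P : probability T R)
    (X : {RV P >-> T1}) (Y : {RV P >-> T2}) (f : T1 * T2 -> R) :
  independent_RV X Y -> bounded_mfun f ->
  \int[P]_w f (X w, Y w) =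
  \int[distribution P X]_x \int[distribution P Y]_y f (x, y).
Proof.
move=> XY bf.
have mXY : measurable_fun setT (fun w => (X w, Y w)) by exact: measurable_fun_pair.
rewrite -(Rintegral_Fubini (distribution P X) (distribution P Y) bf).1.
apply/esym; apply: (@Rintegral_pushforward _ _ T (T1 * T2)%type R P
  (product_probability (distribution P X) (distribution P Y)) _ f mXY bf) => B mB.
exact: (@product_measure_unique _ _ _ _ R (distribution P X) (distribution P Y)
  (pushforward_measure P mXY) XY).
Qed.

Lemma dotv_stochastic m k (A : 'M[R]_(m, k)) (t mu : 'cV[R]_m) q (u : 'cV[R]_k) :
  dotv t (mu + q *: (A *m u)) = dotv t mu + dotv (q *: (A^T *m t)) u.
Proof. by rewrite dotvDr dotvZr dotv_mulmxr dotvZl. Qed.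

(** Conditioning on [Q], the integral of [cos (sqrt Q * (v . u))] depends only on
    the norm of [v], by rotation invariance of [u], and the sine integral
    vanishes.  At [v = A^T t] the squared norm of [v] is the quadratic form of
    [A A^T] at [t], so the generator at [s] can be read off at any [v] of
    squared norm [s]. *)
Lemma stochastic_representation_RES (m k : nat) (mu : 'cV[R]_m)
    (A : 'M[R]_(m, k))
    d (T : measurableType d) (P : probability T R) (x : {RV P >-> 'cV[R]_m})
    d' (T' : measurableType d') (P' : probability T' R)
    (Q : {RV P' >-> R}) (u : {RV P' >-> 'cV[R]_k}) :
  (0 < k)%N -> sym_psd (A *m A^T) -> uniform_on_sphere u -> independent_RV Q u ->
  eq_in_distribution P P' x (fun w => mu + Num.sqrt (Q w) *: (A *m u w)) ->
  exists phi : R -> R, RES x mu (A *m A^T) phi.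
Proof.
move=> k0 psd uu Qu xE.
have mu' : measurable_fun setT u by [].
have mQ : measurable_fun setT (fun w => Num.sqrt (Q w)).
  exact: measurableT_comp (@measurable_sqrt R) _.
pose Z w := mu + Num.sqrt (Q w) *: (A *m u w).
have mZ : measurable_fun setT Z.
  apply: measurable_addcV; first exact: measurable_cst.
  by apply: measurable_scalecV => //; exact: measurable_mulmx.
have transfer f : bounded_mfun f -> \int[P]_w f (x w) = \int[P']_w f (Z w).
  move=> bf; have mx : measurable_fun setT x by [].
  rewrite -(@Rintegral_pushforward _ _ _ _ R P (pushforward_measure P mx) x f)//.
  by apply: Rintegral_pushforward => // B mB; exact: xE.
have mt n (t : 'cV[R]_n) : measurable_fun setT (fun v : 'cV[R]_n => dotv t v).
  exact: measurable_dotv.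
have mdir (v : 'cV[R]_k) :
    measurable_fun setT (fun p : R * 'cV[R]_k => dotv (Num.sqrt p.1 *: v) p.2).
  apply: measurable_dotv; last exact: measurable_snd.
  apply: measurable_scalecV; last exact: measurable_cst.
  exact: measurableT_comp (@measurable_sqrt R) measurable_fst.
pose C v := \int[P']_w cos (dotv (Num.sqrt (Q w) *: v) (u w)).
have inv := uniform_on_sphere_orthogonal k0 uu.
have CE v w : dotv v v = dotv w w -> C v = C w.
  move=> vw; rewrite /C.
  rewrite (Rintegral_independent Qu (bounded_mfun_cos (mdir v))).
  rewrite (Rintegral_independent Qu (bounded_mfun_cos (mdir w))).
  apply: eq_Rintegral => q _ /=; apply: (rotation_invariant_cos inv).
  by rewrite !dotvZl !dotvZr vw.
have S0 v : \int[P']_w sin (dotv (Num.sqrt (Q w) *: v) (u w)) = 0.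
  rewrite (Rintegral_independent Qu (bounded_mfun_sin (mdir v))) /=.
  under eq_Rintegral do rewrite (rotation_invariant_sin inv).
  by rewrite Rintegral_cst// mul0r.
have bQ v : bounded_mfun (fun w => cos (dotv (Num.sqrt (Q w) *: v) (u w))) /\
    bounded_mfun (fun w => sin (dotv (Num.sqrt (Q w) *: v) (u w))).
  have mv : measurable_fun setT (fun w => dotv (Num.sqrt (Q w) *: v) (u w)).
    by apply: measurable_dotv => //; exact: measurable_scalecV.
  by split; [exact: bounded_mfun_cos | exact: bounded_mfun_sin].
have intZ (f : T' -> R) c : bounded_mfun f ->
    P'.-integrable setT (EFin \o (fun w => c * f w)).
  by move=> bf; apply: bounded_mfun_integrable; exact: bounded_mfunM (bounded_mfun_cst _ _) bf.
pose e : 'cV[R]_k := delta_mx (Ordinal k0) ord0.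
have ee : dotv e e = 1.
  rewrite dotvE (bigD1 (Ordinal k0))//= mxE !eqxx mul1r big1 ?addr0// => j j0.
  by rewrite mxE (negbTE j0) mul0r.
exists (fun s => C (Num.sqrt s *: e)); apply/RESP; split => // t.
rewrite qform_mulmx_trmx (CE _ (A^T *m t)); last first.
  by rewrite dotvZl dotvZr ee mulr1 -expr2 sqr_sqrtr// dotvv_ge0.
have [bc bs] := bQ (A^T *m t).
split.
- rewrite (transfer (fun v => cos (dotv t v))); last first.
    by apply: bounded_mfun_cos; exact: mt.
  under eq_Rintegral do rewrite dotv_stochastic cosD.
  by rewrite RintegralB ?RintegralZl ?S0 ?mulr0 ?subr0//;
    [exact: bounded_mfun_integrable..|exact: intZ|exact: intZ].
- rewrite (transfer (fun v => sin (dotv t v))); last first.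
    by apply: bounded_mfun_sin; exact: mt.
  under eq_Rintegral do rewrite dotv_stochastic sinD.
  by rewrite RintegralD ?RintegralZl ?S0 ?mulr0 ?addr0//;
    [exact: bounded_mfun_integrable..|exact: intZ|exact: intZ].
Qed.

(** With [t = L^T s] one has [A^T t = s], so the characteristic function of
    [L (x - mu)] at [s] is that of [x - mu] at [t]: it is radial. *)
Lemma RES_whitened m k (mu : 'cV[R]_m) (A : 'M[R]_(m, k)) (L : 'M[R]_(k, m))
    d (T : measurableType d) (P : probability T R) (x : {RV P >-> 'cV[R]_m}) phi :
  L *m A = 1%:M -> RES x mu (A *m A^T) phi -> forall s : 'cV[R]_k,
  \int[P]_w cos (dotv s (L *m (x w - mu))) = phi (dotv s s).
Proof.
move=> LA /RESP[_ h] s; pose t := L^T *m s.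
have AtE : A^T *m t = s by rewrite /t mulmxA -trmx_mul LA trmx1 mul1mx.
have [hc hs] := h t.
rewrite qform_mulmx_trmx AtE in hc hs.
have mx : measurable_fun setT (fun w => dotv t (x w)) by exact: measurable_dotv.
have dE w : dotv s (L *m (x w - mu)) = dotv t (x w) - dotv t mu.
  by rewrite dotv_mulmxr -/t dotvDr dotvNr.
under eq_Rintegral do rewrite dE cosB.
rewrite RintegralD//; last 2 first.
- by apply: bounded_mfun_integrable; apply: bounded_mfunM;
    [exact: bounded_mfun_cos | exact: bounded_mfun_cst].
- by apply: bounded_mfun_integrable; apply: bounded_mfunM;
    [exact: bounded_mfun_sin | exact: bounded_mfun_cst].
rewrite RintegralZr//; last by apply: bounded_mfun_integrable; exact: bounded_mfun_cos.
rewrite RintegralZr//; last by apply: bounded_mfun_integrable; exact: bounded_mfun_sin.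
rewrite hc hs; have := cos2Dsin2 (dotv t mu); set a := cos _; set b := sin _ => ab.
transitivity ((a ^+ 2 + b ^+ 2) * phi (dotv s s)); first by ring.
by rewrite ab mul1r.
Qed.

(** If [y] has a radial characteristic function and [u] is an independent
    uniform vector on the sphere, then the norm of [y] times [u] has the same
    characteristic function as [y].  By rotation invariance the average over
    [u] of [cos (|y| (v . u))] equals that of [cos (|v| (y . u))], both [|y| v]
    and [|v| y] having norm [|v| |y|].  Averaging the latter over [y] first
    gives the generator at the squared norm of [|v| u], which is constant as
    [u] has norm 1. *)
Lemma spherical_mixture k d (T : measurableType d) (P : probability T R)
    (y : T -> 'cV[R]_k) (s : probability 'cV[R]_k R) (phi : R -> R) :
  measurable_fun setT y ->
  (forall H : 'M[R]_k, H^T *m H = 1%:M -> forall B, measurable B ->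
     s [set v | B (H *m v)] = s B) ->
  s (@usphere R k) = 1%E ->
  (forall v, \int[P]_w cos (dotv v (y w)) = phi (dotv v v)) ->
  forall v : 'cV[R]_k,
  \int[product_probability P s]_p cos (dotv (enorm (y p.1) *: v) p.2) =
    phi (dotv v v) /\
  \int[product_probability P s]_p sin (dotv (enorm (y p.1) *: v) p.2) = 0.
Proof.
move=> my sinv s1 yphi v.
have my1 : measurable_fun setT (fun p : T * 'cV[R]_k => y p.1).
  exact: measurableT_comp my measurable_fst.
have mf : measurable_fun setT
    (fun p : T * 'cV[R]_k => dotv (enorm (y p.1) *: v) p.2).
  apply: measurable_dotv; last exact: measurable_snd.
  by apply: measurable_scalecV; [exact: measurable_enorm | exact: measurable_cst].
have mg : measurable_fun setT
    (fun p : T * 'cV[R]_k => dotv (enorm v *: p.2) (y p.1)).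
  apply: measurable_dotv => //.
  by apply: measurable_scalecV; [exact: measurable_cst | exact: measurable_snd].
have [fubf _] := Rintegral_Fubini P s (bounded_mfun_cos mf).
have [fubs _] := Rintegral_Fubini P s (bounded_mfun_sin mf).
have [fubg1 fubg2] := Rintegral_Fubini P s (bounded_mfun_cos mg).
split; last first.
  rewrite fubs /=; under eq_Rintegral do rewrite (rotation_invariant_sin sinv).
  by rewrite Rintegral_cst// mul0r.
rewrite fubf /=.
transitivity (\int[P]_w \int[s]_u cos (dotv (enorm v *: u) (y w))).
  apply: eq_Rintegral => w _.
  rewrite (rotation_invariant_cos sinv (w := enorm v *: y w)).
    by apply: eq_Rintegral => u _; rewrite !dotvZl dotvC.
  by rewrite !dotvZl !dotvZr -!enorm_sqr; ring.
rewrite -fubg1 fubg2 /=.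
apply: (@Rintegral_full_set _ _ _ s (@usphere R k)) => //.
- exact: measurable_usphere.
- exact: (measurable_Rintegral2 P s (bounded_mfun_cos mg)).
- move=> u u1; rewrite yphi dotvZl dotvZr -!enorm_sqr u1.
  by rewrite expr1n mulr1 -expr2.
Qed.

(** The space of [x] is enlarged by an independent uniform direction [u], and
    [Q] is the squared norm of [L (x - mu)].  By [spherical_mixture] the
    candidate and [x] have the same characteristic function. *)
Lemma RES_stochastic_representation (m k : nat) (mu : 'cV[R]_m)
    (A : 'M[R]_(m, k)) (L : 'M[R]_(k, m))
    d (T : measurableType d) (P : probability T R) (x : {RV P >-> 'cV[R]_m}) phi :
  (0 < k)%N -> L *m A = 1%:M -> RES x mu (A *m A^T) phi ->
  exists (d' : measure_display) (T' : measurableType d') (P' : probability T' R)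
    (Q : {RV P' >-> R}) (u : {RV P' >-> 'cV[R]_k}),
  [/\ forall w, 0 <= Q w, uniform_on_sphere u, independent_RV Q u &
      eq_in_distribution P P' x
        (fun w => mu + Num.sqrt (Q w) *: (A *m u w))].
Proof.
move=> k0 LA xRES.
have [s sE] := uniform_sphere_probability R k0.
have sinv (H : 'M[R]_k) : H^T *m H = 1%:M -> forall B, measurable B ->
    s [set v | B (H *m v)] = s B.
  move=> HH B mB; rewrite !sE//; last first.
    apply: measurable_preimageT mB.
    by apply: measurable_mulmx; exact: measurable_id.
  by rewrite sphere_area_orthogonal.
have s1 : s (@usphere R k) = 1%E.
  rewrite sE; last exact: measurable_usphere.
  by rewrite sphere_area_usphere -sE// probability_setT.
pose y w := L *m (x w - mu).
have my : measurable_fun setT y.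
  have mx : measurable_fun setT x by [].
  by apply: measurable_mulmx; apply: measurable_addcV mx _; exact: measurable_cst.
have my1 : measurable_fun setT (fun p : T * 'cV[R]_k => y p.1).
  exact: measurableT_comp my measurable_fst.
pose P' := product_probability P s.
have mQ : measurable_fun setT (fun p : T * 'cV[R]_k => dotv (y p.1) (y p.1)).
  exact: measurable_dotv.
pose Q : {RV P' >-> R} := HB.pack (fun p : T * 'cV[R]_k => dotv (y p.1) (y p.1))
  (isMeasurableFun.Build _ _ _ _ _ mQ).
pose u : {RV P' >-> 'cV[R]_k} := HB.pack (fun p : T * 'cV[R]_k => p.2)
  (isMeasurableFun.Build _ _ _ _ _ measurable_snd).
have prodT (B : set 'cV[R]_k) : measurable B -> P' (setT `*` B) = s B.
  move=> mB; transitivity (P setT * s B)%E; first exact: product_measure1E.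
  by rewrite -[RHS]mul1e; congr (_ * _)%E; exact: probability_setT.
have prodTr (C : set T) : measurable C -> P' (C `*` setT) = P C.
  move=> mC; transitivity (P C * s setT)%E; first exact: product_measure1E.
  by rewrite -[RHS]mule1; congr (_ * _)%E; exact: probability_setT.
exists _, _, P', Q, u; split.
- by move=> w; exact: dotvv_ge0.
- move=> B mB; rewrite -sE// /distribution /pushforward.
  rewrite (_ : u @^-1` B = setT `*` B); last first.
    by apply/seteqP; split => p //= [].
  exact: prodT.
- move=> C B mC mB.
  pose q w := dotv (y w) (y w).
  have mq : measurable (q @^-1` C).
    by apply: measurable_preimageT mC; exact: measurable_dotv.
  have E1 : Q @^-1` C = (q @^-1` C) `*` setT.
    by apply/seteqP; split => p //= [].
  have E2 : u @^-1` B = setT `*` B by apply/seteqP; split => p //= [].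
  rewrite E1 E2 -setXI setIT setTI prodT// prodTr//.
  exact: product_measure1E.
pose Z w := mu + Num.sqrt (Q w) *: (A *m u w).
have mZ : measurable_fun setT Z.
  apply: measurable_addcV; first exact: measurable_cst.
  apply: measurable_scalecV; last exact: measurable_mulmx.
  exact: measurableT_comp (@measurable_sqrt R) _.
pose Zr : {RV P' >-> 'cV[R]_m} := HB.pack Z (isMeasurableFun.Build _ _ _ _ _ mZ).
have mix := spherical_mixture my sinv s1 (RES_whitened LA xRES).
have [_ xphi] := (RESP x mu (A *m A^T) phi).1 xRES.
have mt (t : 'cV[R]_m) : measurable_fun setT (fun v : 'cV[R]_m => dotv t v).
  exact: measurable_dotv.
have md v : measurable_fun setT
    (fun p : T * 'cV[R]_k => dotv (enorm (y p.1) *: v) p.2).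
  apply: measurable_dotv; last exact: measurable_snd.
  by apply: measurable_scalecV; [exact: measurable_enorm | exact: measurable_cst].
have bc v := bounded_mfun_cos (md v).
have bs v := bounded_mfun_sin (md v).
have dE t w : dotv t (Z w) =
    dotv t mu + dotv (enorm (y w.1) *: (A^T *m t)) w.2.
  by rewrite /Z dotv_stochastic enormE.
have intZ (f : T * 'cV[R]_k -> R) c : bounded_mfun f ->
    P'.-integrable setT (EFin \o (fun w => c * f w)).
  by move=> bf; apply: bounded_mfun_integrable; exact: bounded_mfunM (bounded_mfun_cst _ _) bf.
apply: (@fourier_unique R m (distribution P x) (distribution P' Zr)) => t.
- have bt : bounded_mfun (fun v : 'cV[R]_m => cos (dotv t v)).
    by apply: bounded_mfun_cos; exact: mt.
  rewrite (@Rintegral_pushforward _ _ _ _ R P _ x (fun v => cos (dotv t v)))//.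
  rewrite (@Rintegral_pushforward _ _ _ _ R P' _ Zr (fun v => cos (dotv t v)))//.
  rewrite (xphi t).1 qform_mulmx_trmx; have [mc ms] := mix (A^T *m t).
  under [RHS]eq_Rintegral do rewrite dE cosD.
  by rewrite RintegralB ?RintegralZl ?mc ?ms ?mulr0 ?subr0//;
    [exact: bounded_mfun_integrable..|exact: intZ|exact: intZ].
- have bt : bounded_mfun (fun v : 'cV[R]_m => sin (dotv t v)).
    by apply: bounded_mfun_sin; exact: mt.
  rewrite (@Rintegral_pushforward _ _ _ _ R P _ x (fun v => sin (dotv t v)))//.
  rewrite (@Rintegral_pushforward _ _ _ _ R P' _ Zr (fun v => sin (dotv t v)))//.
  rewrite (xphi t).2 qform_mulmx_trmx; have [mc ms] := mix (A^T *m t).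
  under [RHS]eq_Rintegral do rewrite dE sinD.
  by rewrite RintegralD ?RintegralZl ?mc ?ms ?mulr0 ?addr0//;
    [exact: bounded_mfun_integrable..|exact: intZ|exact: intZ].
Qed.

End elliptical.

Theorem theorem1 (R : realType) (m k : nat) (mu : 'cV[R]_m)
    (Sigma : 'M[R]_m) (A : 'M[R]_(m, k))
    (d : measure_display) (T : measurableType d) (P : probability T R)
    (x : {RV P >-> 'cV[R]_m}) :
  (1 <= m)%N -> sym_psd Sigma -> \rank Sigma = k -> (1 <= k <= m)%N ->
  Sigma = A *m A^T ->
  (exists phi : R -> R, RES x mu Sigma phi) <->
  (exists (d' : measure_display) (T' : measurableType d')
          (P' : probability T' R)
          (Q : {RV P' >-> R}) (u : {RV P' >-> 'cV[R]_k}),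
     [/\ forall w, 0 <= Q w,
         uniform_on_sphere u,
         independent_RV Q u &
         eq_in_distribution P P' x
           (fun w => mu + Num.sqrt (Q w) *: (A *m u w))]).
Proof.
move=> _ psd rk /andP[k0 _] SigmaE; split.
  move=> [phi]; rewrite SigmaE => xRES.
  (* [A] has rank at least that of [A A^T], so it has a left inverse. *)
  have Afull : row_full A.
    rewrite /row_full eqn_leq rank_leq_col/= -[X in (X <= _)%N]rk SigmaE.
    by rewrite mxrankM_maxl.
  exact: (RES_stochastic_representation k0 (mulVpmx Afull) xRES).
rewrite SigmaE in psd *.
move=> [d' [T' [P' [Q [u [_ uu Qu xE]]]]]].
exact: stochastic_representation_RES k0 psd uu Qu xE.
Qed.
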